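(* Let $f$ be a transcendental entire function with a multiply connected wandering domain $U$, and let $z_0\in U$. For large $n\in\mathbb{N}$ let $r_n=|f^n(z_0)|$, let $A(r_n^{a_n},r_n^{b_n})$ be the maximal annulus centred at $0$ that is contained in $U_n=f^n(U)$ and contains $f^n(z_0)$, and let $b=\lim_{n\to\infty}b_n\in(1,\infty]$. If $U$ has eventual outer connectivity $2$, then $b$ is finite.
   Context: $A(r,R)=\{z\in\mathbb{C}:r<|z|<R\}$ for $0<r<R$. A transcendental entire function is an entire function $f:\mathbb{C}\to\mathbb{C}$ that is not a polynomial; $f^n$ denotes its $n$-th iterate, and $\mathbb{N}=\{1,2,\dots\}$. The Fatou set $F(f)$ is the set of points of $\mathbb{C}$ having a neighbourhood on which the iterates $f^n$ form a normal family (locally uniform convergence to $\infty$ being allowed). A Fatou component is a connected component of $F(f)$. For a Fatou component $U$, $U_n$ denotes the Fatou component containing $f^n(U)$, with $U_0=U$; $U$ is a wandering domain if the sequence $(U_n)$ is not eventually periodic. A domain is multiply connected if it is not simply connected. By results of Baker, if $U$ is a multiply connected wandering domain then each $U_n$ is bounded and multiply connected, $U_n=f^n(U)$, for all large $n$ both $U_n$ and $0$ lie in a bounded complementary component of $U_{n+1}$, and $\mathrm{dist}(U_n,0)\to\infty$ as $n\to\infty$. There exists $\alpha>0$ such that, for all large $n$, the maximal annulus centred at $0$ that is contained in $U_n$ and contains $f^n(z_0)$ exists and has the form $A(r_n^{a_n},r_n^{b_n})$ with $0<a_n<1-\alpha<1+\alpha<b_n$; this defines $a_n,b_n$. The limit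 $b\in(1,\infty]$ exists. The connectivity $c(G)$ of a domain $G\subset\mathbb{C}$ is the number of connected components of the complement of $G$ in the Riemann sphere. For large $n$ put $U_n^{+}=U_n\cap\{z:|z|>r_n\}$; the outer connectivity of $U_n$ is $c(U_n^+)$. $U$ has eventual outer connectivity $c$ if $U_n$ has outer connectivity $c$ for all large $n$. *)

(* Defs.v *)
From HB Require Import structures.
From mathcomp Require Import all_boot all_order all_algebra.
From mathcomp Require Import all_classical all_reals all_analysis.
From mathcomp Require Import complex.

Set Implicit Arguments.
Unset Strict Implicit.
Unset Printing Implicit Defensive.

Import Order.TTheory GRing.Theory Num.Theory.
Import numFieldNormedType.Exports.

Local Open Scope classical_set_scope.
Local Open Scope ring_scope.

(* The complex field over R.  Keeping it folded as a numClosedFieldType makes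
   its topology and its C-normed module structure (hence complex
   differentiability) those of the library. *)
Definition Cplx (R : realType) : numClosedFieldType := R[i].

Section Complex_dynamics.
Context {R : realType}.
Local Notation C := (Cplx R).

(* The R-valued modulus; the generic norm `|z| takes values in C itself. *)
Definition cmod (z : C) : R := ComplexField.Normc.normc (z : R[i]).

Definition annulus (r s : R) : set C := [set z | r < cmod z < s].

Definition entire (f : C -> C) : Prop := forall z, derivable f z 1.

Definition transcendental_entire (f : C -> C) : Prop :=
  entire f /\ ~ exists p : {poly C}, forall z, f z = p.[z].

Definition cvg_locally_uniformly (D : set C) (g : nat -> C -> C) (h : C -> C) :=
  forall z, D z -> exists2 V : set C, nbhs z V & {uniform V, g @ \oo --> h}.

Definition cvg_locally_uniformly_infty (D : set C) (g : nat -> C -> C) :=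
  forall z, D z -> exists2 V : set C, nbhs z V &
    forall M : R, \forall k \near \oo, forall w, V w -> M < cmod (g k w).

Definition normal_family (D : set C) (F : set (C -> C)) : Prop :=
  forall g : nat -> C -> C, (forall k, F (g k)) ->
    exists2 phi : nat -> nat, {homo phi : m n / (m < n)%N} &
      (exists h, cvg_locally_uniformly D (g \o phi) h) \/
      cvg_locally_uniformly_infty D (g \o phi).

Definition iterates (f : C -> C) : set (C -> C) :=
  [set iter n f | n in [set n | (0 < n)%N]].

Definition fatou_set (f : C -> C) : set C :=
  [set z | exists D, [/\ open D, D z & normal_family D (iterates f)]].

Definition fatou_component (f : C -> C) (U : set C) : Prop :=
  exists2 z, fatou_set f z & U = connected_component (fatou_set f) z.

(* U_n, the Fatou component containing f^n(U).  As f^n(U) is a connected subset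
   of the Fatou set, all terms of the union are the same component. *)
Definition fatou_orbit (f : C -> C) (U : set C) (n : nat) : set C :=
  \bigcup_(w in iter n f @` U) connected_component (fatou_set f) w.

Definition wandering_domain (f : C -> C) (U : set C) : Prop :=
  fatou_component f U /\
  ~ exists N p : nat, (0 < p)%N /\
      forall n, (N <= n)%N -> fatou_orbit f U (n + p) = fatou_orbit f U n.

(* The complement of G in the Riemann sphere. *)
Definition sphere_compl (G : set C) : set (one_point_compactification C) :=
  ~` (Some @` G).

Definition has_connectivity (G : set C) (c : nat) : Prop :=
  (connected_component (sphere_compl G) @` sphere_compl G #= `I_c)%card.

(* Ahlfors' definition of simple connectivity of a plane domain: its complement
   with respect to the extended plane is connected. *)
Definition simply_connected (G : set C) : Prop := connected (sphere_compl G).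

Definition multiply_connected (G : set C) : Prop := ~ simply_connected G.

(* The largest annulus centred at 0 that is contained in G and contains w. *)
Definition maximal_annulus (G : set C) (w : C) (r s : R) : Prop :=
  [/\ 0 < r < s, annulus r s `<=` G, annulus r s w &
      forall r' s', 0 < r' < s' -> annulus r' s' `<=` G -> annulus r' s' w ->
        annulus r' s' `<=` annulus r s].

Definition outer_part (f : C -> C) (U : set C) (z0 : C) (n : nat) : set C :=
  fatou_orbit f U n `&` [set z | cmod (iter n f z0) < cmod z].

Definition eventual_outer_connectivity
    (f : C -> C) (U : set C) (z0 : C) (c : nat) : Prop :=
  \forall n \near \oo, has_connectivity (outer_part f U z0 n) c.

End Complex_dynamics.

(* Main.v *)
Require Import Defs.
From HB Require Import structures.
From mathcomp Require Import all_boot all_order all_algebra.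
From mathcomp Require Import all_classical all_reals all_analysis.
From mathcomp Require Import complex.
From mathcomp Require Import ring lra zify.

(** Write U_n for the n-th Fatou component, r_n = |f^n(z0)|, and fix a large m.
For n > m the map g = f^(n-m) sends U_m into U_n and its boundary into the Julia
set, hence off the maximal annulus of U_n: on the boundary of U_m either
|g| <= r_n^{a_n} or |g| >= r_n^{b_n}. The sphere being unicoherent, one of these
two parts of the boundary lies in a compact, relatively open subset K of the
complement of U_m. If it were the second part, the maximum principle on the union
of U_m and K would give |g| <= r_n^{a_n} at f^m(z0), where |g| = r_n. So it is the
first part, and outer connectivity 2 forces K into |z| <= r_m; thus
|g| >= r_n^{b_n} on the part of the boundary of U_m outside that disc. Since
|g| >= 1 on U_m, the minimum principle compares log|g| with a multiple of log|z|
and yields log r_n >= c b_n log r_n with c > 0 depending on m only, so b_n stays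
bounded.

Baker's theorems are not needed: that the annuli are nested and r_n tends to
infinity follows from Montel's theorem, because a disc on which the iterates stay
bounded lies in the Fatou set and cannot meet two of the pairwise disjoint U_n.
All the function theory comes from the maximum principle, itself a consequence of
the mean value property obtained from Goursat's bisection. *)

Set Implicit Arguments.
Unset Strict Implicit.
Unset Printing Implicit Defensive.

Import Order.TTheory GRing.Theory Num.Theory.
Import numFieldNormedType.Exports.

Local Open Scope classical_set_scope.
Local Open Scope ring_scope.

(** * Modulus and complex differentiability *)

(* An abstract field keeps unification from unfolding the complex field. *)
Section Derivation.
Context {K : numClosedFieldType}.
Implicit Types (f g : K -> K) (z : K).

(** Logarithms and harmonic functions are avoided: comparing log|g| with a multiple of log|z| is the
    maximum principle for z^p / g with a natural number p, holomorphic because g does not vanish on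
    the closure of U_m. Only whole multiples of log|z| are then available. Rounding costs at most a
    factor 2, so the contradiction asks b_n to be twice as large as real exponents would require.
    The topological obstacle is that U_m is treated as an arbitrary bounded domain, with no
    separating curve at hand. A function equal to 0 on one boundary part and to 1 on the other is
    therefore extended by 0 off U_m. Modulo 1 the result is continuous, so it lifts over the plane,
    and the integer values of the lift off U_m do the separating. *)

Lemma derivable1_comp f g z : derivable f z 1 -> derivable g (f z) 1 ->
  derivable (g \o f) z 1.
Proof.
move=> /derivable1_diffP fz /derivable1_diffP gz; apply/derivable1_diffP.
exact: differentiable_comp.
Qed.

Lemma derivable1M f g z : derivable f z 1 -> derivable g z 1 ->
  derivable (fun w => f w * g w) z 1.
Proof. exact: derivableM. Qed.

Lemma derivable1V f z : derivable f z 1 -> f z != 0 ->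
  derivable (fun w => (f w)^-1) z 1.
Proof. by move=> fz f0; exact: derivableV. Qed.

Lemma derivable1D f g z : derivable f z 1 -> derivable g z 1 ->
  derivable (fun w => f w + g w) z 1.
Proof. exact: derivableD. Qed.

Lemma derivable1_cst (c z : K) : derivable (fun=> c) z 1.
Proof. exact: derivable_cst. Qed.

Lemma derivable1_id (z : K) : derivable (fun w => w) z 1.
Proof. exact: derivable_id. Qed.

Lemma derivable1_cts f z : derivable f z 1 -> {for z, continuous f}.
Proof. by move=> /derivable1_diffP /differentiable_continuous. Qed.

End Derivation.
Section Modulus.
Context {R : realType}.
Local Notation C := (Cplx R).
Implicit Types z w : C.

Lemma cmod_norm z : (cmod z)%:C%C = `|z|.
Proof. by []. Qed.

Lemma cmod_ge0 z : 0 <= cmod z.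
Proof. by have := normr_ge0 z; rewrite -cmod_norm lecR. Qed.

Lemma cmod0 : cmod (0 : C) = 0.
Proof. exact: ComplexField.Normc.normc0. Qed.

Lemma cmod1 : cmod (1 : C) = 1.
Proof. exact: ComplexField.Normc.normc1. Qed.

Lemma cmod_eq0 z : (cmod z == 0) = (z == 0).
Proof.
apply/eqP/eqP => [/ComplexField.Normc.eq0_normc//|->]; exact: cmod0.
Qed.

Lemma cmod_gt0 z : (0 < cmod z) = (z != 0).
Proof. by rewrite lt_neqAle cmod_ge0 andbT eq_sym cmod_eq0. Qed.

Lemma cmodM z w : cmod (z * w) = cmod z * cmod w.
Proof. exact: ComplexField.Normc.normcM. Qed.

Lemma cmodV z : cmod z^-1 = (cmod z)^-1.
Proof. exact: ComplexField.Normc.normcV. Qed.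

Lemma cmodX z n : cmod (z ^+ n) = cmod z ^+ n.
Proof. by elim: n => [|n IH]; rewrite ?expr0 ?cmod1// !exprS cmodM IH. Qed.

Lemma cmodN z : cmod (- z) = cmod z.
Proof. by apply: (@complexI R); rewrite !cmod_norm normrN. Qed.

Lemma cmodD z w : cmod (z + w) <= cmod z + cmod w.
Proof. by rewrite -lecR rmorphD /= !cmod_norm ler_normD. Qed.

Lemma cmodB z w : cmod (z - w) = cmod (w - z).
Proof. by rewrite -cmodN opprB. Qed.

Lemma cmod_dist z w t : cmod (z - w) <= cmod (z - t) + cmod (t - w).
Proof. by rewrite (le_trans _ (cmodD _ _))// addrA subrK. Qed.

Lemma cmod_leB z w : cmod z - cmod w <= cmod (z - w).
Proof. by rewrite lerBlDr (le_trans _ (cmodD _ _))// subrK. Qed.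

Lemma cmodR (x : R) : cmod (x%:C%C : C) = `|x|.
Proof. by rewrite /cmod /= expr0n addr0 sqrtr_sqr. Qed.

Lemma nbhs_cmodP z (V : set C) :
  nbhs z V <-> exists2 d : R, 0 < d & forall w, cmod (w - z) < d -> V w.
Proof.
split.
  move=> /nbhs_ballP[e /= e0 eV].
  have eE : e = (complex.Re e)%:C%C by rewrite RRe_real// gtr0_real.
  exists (complex.Re e); first by rewrite -ltcR -eE.
  move=> w wz; apply: eV; rewrite -ball_normE /= distrC -cmod_norm eE.
  by rewrite ltcR.
move=> [d d0 dV]; apply/nbhs_ballP; exists d%:C%C; first by rewrite /= ltcR.
by move=> w; rewrite -ball_normE /= distrC -cmod_norm ltcR; exact: dV.
Qed.

(** Freed of the quotient, the expansion also covers w = z and keeps all later estimates over the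
    reals. *)
Lemma derivable_cmodP (f : C -> C) z :
  derivable f z 1 <-> exists L : C, forall e : R, 0 < e ->
    exists2 d : R, 0 < d & forall w, cmod (w - z) < d ->
      cmod (f w - f z - L * (w - z)) <= e * cmod (w - z).
Proof.
split.
  move=> fd; exists ('D_1 f z) => e e0; set L := 'D_1 f z.
  have /cvgrPdist_le fL :
    h^-1 *: ((f \o shift z) (h *: 1) - f z) @[h --> 0^'] --> (L : C) := fd.
  have /fL : 0 < (e%:C%C : C) by rewrite ltcR.
  rewrite /prop_near1 /dnbhs /within /= => /nbhs_cmodP[d d0 dL].
  exists d => // w wz; have [->|wNz] := eqVneq w z.
    by rewrite !subrr mulr0 subrr !cmod0 mulr0.
  have wz0 : w - z != 0 by rewrite subr_eq0.
  have := dL (w - z); rewrite subr0 => /(_ wz wz0).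
  rewrite -cmod_norm lecR [_ *: 1]mulr1 subrK.
  rewrite -(ler_pM2r (_ : 0 < cmod (w - z))) ?cmod_gt0//.
  by rewrite -cmodM mulrBl [_ *: _]mulrC divfK// cmodB.
move=> [L fL].
suff fL' : h^-1 *: ((f \o shift z) (h *: 1) - f z) @[h --> 0^'] --> (L : C).
  by apply/cvg_ex; exists L.
apply/cvgrPdist_le => /= e e0.
have eE : e = (complex.Re e)%:C%C by rewrite RRe_real// gtr0_real.
have e0' : 0 < complex.Re e by rewrite -ltcR -eE.
have [d d0 dL] := fL _ e0'.
rewrite /prop_near1 /dnbhs /within /=; apply/nbhs_cmodP; exists d => // h hd h0.
rewrite subr0 in hd; have := dL (h + z); rewrite addrK => /(_ hd) dLh.
rewrite eE -cmod_norm lecR [_ *: 1]mulr1.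
rewrite -(ler_pM2r (_ : 0 < cmod h)) ?cmod_gt0// -cmodM.
by rewrite mulrBl [_ *: _]mulrC divfK// cmodB.
Qed.

Lemma derivable_cmod_cts (f : C -> C) z : derivable f z 1 ->
  forall e : R, 0 < e -> exists2 d : R, 0 < d &
    forall w, cmod (w - z) < d -> cmod (f w - f z) < e.
Proof.
move=> /derivable1_cts fz e e0.
have /fz/nbhs_cmodP// : nbhs (f z) [set y | cmod (y - f z) < e].
by apply/nbhs_cmodP; exists e.
Qed.

Lemma cmod_derivable_cts (g : C -> C) z (e : R) : derivable g z 1 -> 0 < e ->
  exists2 d : R, 0 < d &
    forall w, cmod (w - z) < d -> `|cmod (g w) - cmod (g z)| < e.
Proof.
move=> /derivable_cmod_cts gz /gz[d d0 dP]; exists d => // w /dP.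
apply: le_lt_trans; rewrite ler_norml; have := cmod_leB (g w) (g z).
by have := cmod_leB (g z) (g w); rewrite (cmodB (g z)); lra.
Qed.

End Modulus.
Arguments cmod {R} z : simpl never.

(** * Compactness in the plane and uniform convergence, with real epsilons *)

Section Compactness.
Context {R : realType}.
Local Notation C := (Cplx R).
Implicit Types z w : C.

Lemma Re_le_cmod z : `|complex.Re z| <= cmod z.
Proof.
case: z => x y; rewrite /cmod /= -sqrtr_sqr ler_wsqrtr// lerDl; exact: sqr_ge0.
Qed.

Lemma Im_le_cmod z : `|complex.Im z| <= cmod z.
Proof.
case: z => x y; rewrite /cmod /= -sqrtr_sqr ler_wsqrtr// lerDr; exact: sqr_ge0.
Qed.

Lemma cmod_le_ReIm z : cmod z <= `|complex.Re z| + `|complex.Im z|.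
Proof.
case: z => x y; rewrite /cmod /= -[leRHS]ger0_norm ?addr_ge0//.
rewrite -[leRHS]sqrtr_sqr ler_wsqrtr// sqrrD !real_normK ?num_real// lerD2r lerDl.
by rewrite mulrn_wge0// mulr_ge0.
Qed.

Lemma open_cmodP (A : set C) :
  open A <-> forall z, A z -> exists2 d : R, 0 < d &
    forall w, cmod (w - z) < d -> A w.
Proof.
rewrite openE; split => oA z Az; first by apply/nbhs_cmodP/oA.
by apply/nbhs_cmodP/oA.
Qed.

Lemma closure_cmodP (A : set C) z :
  closure A z <-> forall d : R, 0 < d -> exists2 w, A w & cmod (w - z) < d.
Proof.
split=> [zA d d0|zA B /nbhs_cmodP[d d0 dB]].
  have /zA[w [Aw wz]] : nbhs z [set w | cmod (w - z) < d].
    by apply/nbhs_cmodP; exists d.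
  by exists w.
by have [w Aw wz] := zA _ d0; exists w; split => //; exact: dB.
Qed.

Lemma cmod_closure_le (A : set C) (M : R) z :
  (forall w, A w -> cmod w <= M) -> closure A z -> cmod z <= M.
Proof.
move=> AM /closure_cmodP Az; apply/ler_addgt0Pl => e e0.
have [w /AM wM wz] := Az _ e0.
have := cmod_leB z w; rewrite cmodB; lra.
Qed.

Lemma compact_closed_bounded (A : set C) (M : R) :
  closed A -> (forall z, A z -> cmod z <= M) -> compact A.
Proof.
move=> cA AM; pose g (p : R * R) : C := (p.1 +i* p.2)%C.
have cg : continuous g.
  move=> [x y] V /nbhs_cmodP[d d0 dV].
  have d20 : 0 < d / 2 by rewrite divr_gt0.
  exists (ball x (d / 2), ball y (d / 2)).
    by split; exact: nbhsx_ballx.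
  move=> [x' y'] /= [xx' yy']; apply: dV.
  apply: le_lt_trans (cmod_le_ReIm _) _ => /=; rewrite [ltRHS]splitr ltrD//.
    by rewrite distrC.
  by rewrite distrC.
have : compact (g @` (`[- M, M] `*` `[- M, M])).
  apply: continuous_compact; first exact: continuous_subspaceT.
  by apply: compact_setX; exact: segment_compact.
move=> /(subclosed_compact cA); apply => z /AM zM; exists (complex.Re z, complex.Im z).
  by split => /=; rewrite in_itv /= -ler_norml (le_trans _ zM)//
    ?Re_le_cmod ?Im_le_cmod.
by case: z {zM}.
Qed.

Lemma evt_max (A : set C) (M : R) (phi : C -> R) :
  closed A -> (forall z, A z -> cmod z <= M) -> A !=set0 ->
  (forall z, A z -> forall e : R, 0 < e -> exists2 d : R, 0 < d &
    forall w, A w -> cmod (w - z) < d -> `|phi w - phi z| < e) ->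
  exists2 c, A c & forall z, A z -> phi z <= phi c.
Proof.
move=> cA AM A0 cphi.
have [|c] := @compact_EVT_max C R phi A A0 (compact_closed_bounded cA AM).
  rewrite continuous_subspace_in => z /set_mem Az V.
  move=> /nbhs_ballP[e /= e0 eV]; have [d d0 dphi] := cphi z Az e e0.
  rewrite /nbhs /= -nbhs_subspace_in//= /within /=; apply/nbhs_cmodP.
  exists d => // w wz Aw; apply: eV; rewrite -ball_normE /= distrC.
  exact: dphi.
by move=> /set_mem Ac cmax; exists c => // z Az; apply: cmax; exact/mem_set.
Qed.

Lemma bolzano_weierstrass_cplx (u : nat -> C) (M : R) :
  (forall k, cmod (u k) <= M) ->
  exists2 phi : nat -> nat, {homo phi : m n / (m < n)%N} &
    exists l : C, forall e : R, 0 < e -> exists N, forall k, (N <= k)%N ->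
      cmod (u (phi k) - l) < e.
Proof.
move=> uM.
have bnd (v : nat -> R) : (forall k, `|v k| <= M) -> bounded_fun v.
  move=> vM; exists M; split; first exact: num_real.
  by move=> x Mx k _ /=; apply: le_trans (vM k) (ltW Mx).
have [phi ophi /cvg_ex[/= x xP]] := bolzano_weierstrass
  (bnd (fun k => complex.Re (u k)) (fun k => le_trans (Re_le_cmod _) (uM k))).
have [psi opsi /cvg_ex[/= y yP]] := bolzano_weierstrass
  (bnd (fun k => complex.Im (u (phi k)))
    (fun k => le_trans (Im_le_cmod _) (uM _))).
have incr (v : nat -> nat) : increasing_seq v -> {homo v : m n / (m < n)%N}.
  by move=> ov m n; rewrite !ltnNge -(ov n m) leEnat.
exists (phi \o psi) => [m n mn|]; first exact/(incr _ ophi)/(incr _ opsi).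
exists (x +i* y)%C => e e0; have e20 : 0 < e / 2 by rewrite divr_gt0.
move/cvgrPdist_lt : xP => /(_ _ e20)[N1 _ N1P].
move/cvgrPdist_lt : yP => /(_ _ e20)[N2 _ N2P].
exists (maxn N1 N2) => k; rewrite geq_max => /andP[N1k N2k].
apply: le_lt_trans (cmod_le_ReIm _) _; rewrite [ltRHS]splitr ltrD//.
  have := N1P (psi k); rewrite /= distrC raddfB; apply.
  apply: leq_trans N1k _; elim: k {N2k} => // k IH.
  by rewrite (leq_ltn_trans IH)// (incr _ opsi).
by have := N2P k N2k; rewrite /= distrC raddfB.
Qed.

Lemma uniform_cmodP (V : set C) (g : nat -> C -> C) (h : C -> C) :
  {uniform V, g @ \oo --> h} <-> forall e : R, 0 < e -> exists N,
    forall k, (N <= k)%N -> forall w, V w -> cmod (h w - g k w) < e.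
Proof.
rewrite restricted_cvgE; split => [gh e e0|gh P /uniform_nbhs[E [entE EP]]].
  have /gh[N _ NP] : nbhs (h : {uniform` V -> C})
      [set q | forall y, V y -> cmod (h y - q y) < e].
    apply/uniform_nbhs; exists [set p | ball p.1 e%:C%C p.2]; split.
      by apply: (@entourage_ball C C (PosNum (_ : 0 < e%:C%C))); rewrite ltcR.
    move=> q /= hq y /hq; rewrite -ball_normE /= -cmod_norm ltcR //.
  by exists N => k /NP.
move: entE; rewrite -entourage_ballE => -[e /= e0 eE].
have eE' : e = (complex.Re e)%:C%C by rewrite RRe_real// gtr0_real.
have e0' : 0 < complex.Re e by rewrite -ltcR -eE'.
have [N NP] := gh _ e0'; exists N => // k Nk; apply: EP => y Vy.
by apply: eE; rewrite /= -ball_normE /= -cmod_norm eE' ltcR; exact: NP.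
Qed.

End Compactness.

(** * Goursat's theorem by Riemann sums *)

Section Goursat.
Context {R : realType}.
Local Notation C := (Cplx R).
Implicit Types (z w : C) (x y a b e : R) (h : C -> C).

Definition cpt (x y : R) : C := (x +i* y)%C.

Lemma cptB x y x' y' : cpt x y - cpt x' y' = cpt (x - x') (y - y').
Proof. by []. Qed.

(* Left-endpoint Riemann sums of h(z) dz. They are exactly additive when the mesh
   is halved and the sums around a rectangle vanish on affine functions, so
   Goursat's bisection runs on them without any integral. *)
Definition hsum h n x y a : C :=
  (a / n%:R)%:C%C * \sum_(j < n) h (cpt (x + j%:R * (a / n%:R)) y).

Definition vsum h n x y b : C :=
  'i%C * (b / n%:R)%:C%C * \sum_(j < n) h (cpt x (y + j%:R * (b / n%:R))).

Definition bsum h n x y a b : C :=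
  hsum h n x y a - hsum h n x (y + b) a + vsum h n (x + a) y b - vsum h n x y b.

Lemma hsum_double h n x y a :
  hsum h (n + n) x y a = hsum h n x y (a / 2) + hsum h n (x + a / 2) y (a / 2).
Proof.
case: n => [|n]; first by rewrite /hsum !big_ord0 !mulr0 addr0.
have nE : a / (n.+1 + n.+1)%:R = a / 2 / n.+1%:R.
  by rewrite natrD -mulrA -invfM mulr2n mulrDl mul1r.
rewrite /hsum big_split_ord /= mulrDr nE; congr (_ + _); congr (_ * _).
apply: eq_bigr => j _; congr (h (cpt _ _)); rewrite natrD mulrDl.
by rewrite [n.+1%:R * _]mulrC divfK ?pnatr_eq0// addrA.
Qed.

Lemma vsum_double h n x y b :
  vsum h (n + n) x y b = vsum h n x y (b / 2) + vsum h n x (y + b / 2) (b / 2).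
Proof.
case: n => [|n]; first by rewrite /vsum !big_ord0 !mulr0 addr0.
have nE : b / (n.+1 + n.+1)%:R = b / 2 / n.+1%:R.
  by rewrite natrD -mulrA -invfM mulr2n mulrDl mul1r.
rewrite /vsum big_split_ord /= mulrDr nE; congr (_ + _); congr (_ * _).
apply: eq_bigr => j _; congr (h (cpt _ _)); rewrite natrD mulrDl.
by rewrite [n.+1%:R * _]mulrC divfK ?pnatr_eq0// addrA.
Qed.

Lemma bsum_double h n x y a b :
  bsum h (n + n) x y a b =
    (bsum h n x y (a / 2) (b / 2) + bsum h n (x + a / 2) y (a / 2) (b / 2)) +
    (bsum h n x (y + b / 2) (a / 2) (b / 2) +
     bsum h n (x + a / 2) (y + b / 2) (a / 2) (b / 2)).
Proof.
rewrite /bsum !hsum_double !vsum_double.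
have half (u v : R) : u + v / 2 + v / 2 = u + v by rewrite -addrA -splitr.
rewrite !half; ring.
Qed.

(** On the affine part, opposite sides differ by the constant -iBb (horizontal) or Ba (vertical) at
    every node, so the two pairs contribute -iabB and iabB and cancel for every n. The remainder is
    at most eta at each node, which leaves perimeter times eta. *)
Lemma bsum_affine h n x y a b (A B p : C) (eta : R) : (0 < n)%N ->
  0 <= a -> 0 <= b ->
  (forall x' y', x <= x' <= x + a -> y <= y' <= y + b ->
     cmod (h (cpt x' y') - A - B * (cpt x' y' - p)) <= eta) ->
  cmod (bsum h n x y a b) <= 2 * (a + b) * eta.
Proof.
move=> n0 a0 b0 hE.
have [r rdef] : exists r : C -> C, forall z, r z = h z - A - B * (z - p).
  by exists (fun z => h z - A - B * (z - p)).
have nR : 0 < n%:R :> R by rewrite ltr0n.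
have nC : n%:R != 0 :> C by rewrite pnatr_eq0 -lt0n.
have -> : bsum h n x y a b = bsum r n x y a b.
  rewrite /bsum /hsum /vsum.
  have [L Ldef] : exists L : R -> R -> C, forall u v, L u v = A + B * (cpt u v - p).
    by exists (fun u v => A + B * (cpt u v - p)).
  have hr (u v : R) : h (cpt u v) = r (cpt u v) + L u v by rewrite rdef Ldef; ring.
  under eq_bigr do rewrite hr.
  under [X in _ - _ * X + _ - _]eq_bigr do rewrite hr.
  under [X in _ - _ + _ * X - _]eq_bigr do rewrite hr.
  under [X in _ - _ + _ - _ * X]eq_bigr do rewrite hr.
  rewrite !big_split /= !mulrDr.
  set h1 := \sum_(i < n) L _ _; set h2 := \sum_(i < n) L _ _.
  set v1 := \sum_(i < n) L _ _; set v2 := \sum_(i < n) L _ _.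
  have hB : h1 - h2 = n%:R * (B * cpt 0 (- b)).
    rewrite /h1 /h2 -sumrB -[n in RHS]card_ord -sum1_card natr_sum mulr_suml.
    apply: eq_bigr => j _; rewrite mul1r.
    have -> : cpt 0 (- b) =
      cpt (x + j%:R * (a / n%:R)) y - cpt (x + j%:R * (a / n%:R)) (y + b).
      by rewrite cptB subrr; congr cpt; ring.
    rewrite !Ldef; ring.
  have vB : v1 - v2 = n%:R * (B * cpt a 0).
    rewrite /v1 /v2 -sumrB -[n in RHS]card_ord -sum1_card natr_sum mulr_suml.
    apply: eq_bigr => j _; rewrite mul1r.
    have -> : cpt a 0 =
      cpt (x + a) (y + j%:R * (b / n%:R)) - cpt x (y + j%:R * (b / n%:R)).
      by rewrite cptB subrr; congr cpt; ring.
    rewrite !Ldef; ring.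
  set t1 := \sum_(i < n) r _; set t2 := \sum_(i < n) r _.
  set t3 := \sum_(i < n) r _; set t4 := \sum_(i < n) r _.
  have -> : (a / n%:R)%:C%C = a%:C%C / n%:R :> C.
    by rewrite rmorphM fmorphV rmorph_nat.
  have -> : (b / n%:R)%:C%C = b%:C%C / n%:R :> C.
    by rewrite rmorphM fmorphV rmorph_nat.
  have cb : cpt 0 (- b) = - ('i%C * b%:C%C).
    by apply/eqP; rewrite eq_complex /=; apply/andP; split; apply/eqP; ring.
  have ca : cpt a 0 = a%:C%C by [].
  have e1 : h1 = h2 + n%:R * (B * cpt 0 (- b)) by rewrite -hB addrC subrK.
  have e2 : v1 = v2 + n%:R * (B * cpt a 0) by rewrite -vB addrC subrK.
  rewrite e1 e2 cb ca; field.
  exact: nC.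
have rE x' y' : x <= x' <= x + a -> y <= y' <= y + b -> cmod (r (cpt x' y')) <= eta.
  by rewrite rdef; exact: hE.
have node (u c : R) (j : 'I_n) : 0 <= c -> u <= u + j%:R * (c / n%:R) <= u + c.
  move=> c0; rewrite lerDl lerD2l mulr_ge0 ?divr_ge0//= mulrCA.
  by rewrite ler_piMr// ler_pdivrMr// mul1r ler_nat ltnW.
have xx : x <= x <= x + a by rewrite lexx lerDl.
have xa : x <= x + a <= x + a by rewrite lexx lerDl a0.
have yy : y <= y <= y + b by rewrite lexx lerDl.
have yb : y <= y + b <= y + b by rewrite lexx lerDl b0.
have sumE (F : 'I_n -> C) : (forall j, cmod (F j) <= eta) ->
    cmod (\sum_(j < n) F j) <= n%:R * eta.
  move=> FE; rewrite -[n in leRHS]card_ord -sum1_card natr_sum mulr_suml.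
  elim/big_ind2 : _ => [|u u' v v' uv uv'|j _]; first by rewrite cmod0.
    by rewrite (le_trans (cmodD _ _))// lerD.
  by rewrite mul1r.
have mid c S : 0 <= c -> S <= n%:R * eta -> c / n%:R * S <= c * eta.
  move=> c0 SE; apply: le_trans (_ : c / n%:R * (n%:R * eta) <= _).
    by rewrite ler_wpM2l// divr_ge0.
  by rewrite mulrA divfK ?lt0r_neq0.
have hle y' : y <= y' <= y + b -> cmod (hsum r n x y' a) <= a * eta.
  move=> y'b; rewrite /hsum cmodM cmodR ger0_norm ?divr_ge0//.
  by apply: mid => //; apply: sumE => j; apply: rE => //; exact: node.
have cmodi : cmod ('i%C : C) = 1.
  by rewrite /cmod /= expr0n expr1n /= add0r sqrtr1.
have vle x' : x <= x' <= x + a -> cmod (vsum r n x' y b) <= b * eta.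
  move=> x'a; rewrite /vsum !cmodM cmodi mul1r cmodR ger0_norm ?divr_ge0//.
  by apply: mid => //; apply: sumE => j; apply: rE => //; exact: node.
rewrite /bsum.
have := cmodD (hsum r n x y a - hsum r n x (y + b) a + vsum r n (x + a) y b)
  (- vsum r n x y b).
have := cmodD (hsum r n x y a - hsum r n x (y + b) a) (vsum r n (x + a) y b).
have := cmodD (hsum r n x y a) (- hsum r n x (y + b) a).
rewrite !cmodN; have := hle _ yy; have := hle _ yb.
have := vle _ xx; have := vle _ xa; lra.
Qed.

End Goursat.

Section Goursat_bisection.
Context {R : realType}.
Local Notation C := (Cplx R).
Implicit Types (z w : C) (x y a b e : R) (h : C -> C).

(** Nested intervals with left ends [u n]: the supremum of the left ends lies in all of them. *)
Lemma halving_limit (u : nat -> R) (d : R) : 0 <= d ->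
  (forall n, u n <= u n.+1 /\ u n.+1 + d / 2 ^+ n.+1 <= u n + d / 2 ^+ n) ->
  exists l, forall n, u n <= l <= u n + d / 2 ^+ n.
Proof.
move=> d0 du.
have up n k : u n <= u (n + k)%N.
  elim: k => [|k IH]; rewrite ?addn0// addnS (le_trans IH)//.
  by have [] := du (n + k)%N.
have dn n k : u (n + k)%N + d / 2 ^+ (n + k) <= u n + d / 2 ^+ n.
  elim: k => [|k IH]; rewrite ?addn0// addnS (le_trans _ IH)//.
  by have [] := du (n + k)%N.
have d2 n : 0 <= d / 2 ^+ n by rewrite divr_ge0// exprn_ge0.
have ub m n : u m <= u n + d / 2 ^+ n.
  have [/subnKC <-|/ltnW/subnKC {1}<-] := leqP n m.
    by rewrite (le_trans _ (dn n (m - n)%N))// lerDl.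
  by rewrite (le_trans (up m (n - m)%N))// lerDl.
have ubn n : ubound (range u) (u n + d / 2 ^+ n).
  by move=> _ [m _ <-]; exact: ub.
exists (sup (range u)) => n; apply/andP; split.
  apply: ub_le_sup; last by exists n.
  by exists (u 0%N + d / 2 ^+ 0); exact: ubn.
by apply: ge_sup => //; exists (u 0%N), 0%N.
Qed.

(** The bound is proportional to the area, so a rectangle that violates it has a violating quarter.
    The successive quarters shrink to a point, where the first-order expansion bounds the sum by a
    small multiple of the squared perimeter; as the rectangles are similar, this is a small multiple
    of the area. *)
Lemma goursat_rectangle h x y a b e : 0 < a -> 0 < b -> 0 < e ->
  (forall x' y', x <= x' <= x + a -> y <= y' <= y + b ->
     derivable h (cpt x' y') 1) ->
  exists N, forall k, (N <= k)%N -> cmod (bsum h (2 ^ k) x y a b) <= e * (a * b).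
Proof.
move=> a0 b0 e0 hd; apply: contrapT => bad0.
pose a_ n := a / 2 ^+ n; pose b_ n := b / 2 ^+ n.
pose bad (t : nat * (R * R)) := ~ exists N, forall k, (N <= k)%N ->
  cmod (bsum h (2 ^ k) t.2.1 t.2.2 (a_ t.1) (b_ t.1)) <= e * (a_ t.1 * b_ t.1).
pose sub n (u v d : R) := u <= v /\ v + d / 2 ^+ n.+1 <= u + d / 2 ^+ n.
pose step (t s : nat * (R * R)) := [/\ s.1 = t.1.+1, sub t.1 t.2.1 s.2.1 a
  & sub t.1 t.2.2 s.2.2 b].
have half c n : c / 2 ^+ n.+1 = c / 2 ^+ n / 2 :> R by rewrite exprSr invfM mulrA.
have halfa n : a_ n.+1 = a_ n / 2 by exact: half.
have halfb n : b_ n.+1 = b_ n / 2 by exact: half.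
have p0 c n : 0 < c -> 0 < c / 2 ^+ n :> R.
  by move=> c0; rewrite divr_gt0// exprn_gt0.
have next t : exists s, bad t -> bad s /\ step t s.
  have [tbad|] := pselect (bad t); last by exists t.
  case: t tbad => n [u v] /= tbad.
  apply: contrapT => noS; apply: tbad => /=.
  have good s : step (n, (u, v)) s -> ~ bad s.
    by move=> ts sb; apply: noS; exists s.
  have good4 u' v' : sub n u u' a -> sub n v v' b -> exists N, forall k, (N <= k)%N ->
      cmod (bsum h (2 ^ k) u' v' (a_ n / 2) (b_ n / 2)) <= e * (a_ n / 2 * (b_ n / 2)).
    move=> su sv; rewrite -halfa -halfb.
    by have /contrapT := good (n.+1, (u', v')) (And3 erefl su sv).
  have an := p0 a n a0; have bn := p0 b n b0.
  have s1 (c w : R) : 0 < c -> sub n w w c.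
    move=> /(p0 c n) c0; split => //; rewrite half lerD2l; lra.
  have s2 (c w : R) : 0 < c -> sub n w (w + c / 2 ^+ n / 2) c.
    move=> /(p0 c n) c0; split; rewrite ?half; lra.
  have [N1 N1P] := good4 _ _ (s1 a u a0) (s1 b v b0).
  have [N2 N2P] := good4 _ _ (s2 a u a0) (s1 b v b0).
  have [N3 N3P] := good4 _ _ (s1 a u a0) (s2 b v b0).
  have [N4 N4P] := good4 _ _ (s2 a u a0) (s2 b v b0).
  (* The successor: a sum with 2^(k+1) nodes on the whole splits into sums with 2^k nodes on the
     quarters. *)
  exists (maxn (maxn N1 N2) (maxn N3 N4)).+1 => -[//|k].
  rewrite ltnS !geq_max => /andP[/andP[k1 k2] /andP[k3 k4]].
  rewrite expnS mul2n -addnn bsum_double.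
  rewrite (_ : e * _ = (e * (a_ n / 2 * (b_ n / 2)) + e * (a_ n / 2 * (b_ n / 2)))
     + (e * (a_ n / 2 * (b_ n / 2)) + e * (a_ n / 2 * (b_ n / 2)))); last by field.
  rewrite (le_trans (cmodD _ _))// lerD//.
    by rewrite (le_trans (cmodD _ _))// lerD// ?N1P ?N2P.
  by rewrite (le_trans (cmodD _ _))// lerD// ?N3P ?N4P.
have [F FP] := choice next.
pose T n := iter n F (0%N, (x, y)).
have Tbad n : bad (T n).
  elim: n => [|n IH]; last by have [] := FP _ IH.
  by move: bad0; rewrite /bad /= /a_ /b_ expr0 !divr1.
have Tstep n : step (T n) (T n.+1) by have [] := FP _ (Tbad n).
have T1 n : (T n).1 = n by elim: n => // n IH; have [-> _ _] := Tstep n; rewrite IH.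
have [X XP] : exists l, forall n, (T n).2.1 <= l <= (T n).2.1 + a / 2 ^+ n.
  by apply: halving_limit (ltW a0) _ => n; have [_ + _] := Tstep n; rewrite T1.
have [Y YP] : exists l, forall n, (T n).2.2 <= l <= (T n).2.2 + b / 2 ^+ n.
  by apply: halving_limit (ltW b0) _ => n; have [_ _ +] := Tstep n; rewrite T1.
have /derivable_cmodP[L LP] : derivable h (cpt X Y) 1.
  apply: hd; first by have := XP 0%N; rewrite expr0 divr1.
  by have := YP 0%N; rewrite expr0 divr1.
have ab0 : 0 < a + b by rewrite addr_gt0.
(* Multiplied by the distance bound (a + b) / 2^n and by the perimeter 2 (a + b) / 2^n, this gives
   exactly e times the area of the n-th rectangle. *)
have e'0 : 0 < e * (a * b) / (2 * (a + b) ^+ 2).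
  by rewrite divr_gt0 ?mulr_gt0 ?exprn_gt0.
have [d d0 dP] := LP _ e'0.
have [n nd] : exists n, (a + b) / 2 ^+ n < d.
  exists (Num.bound ((a + b) / d)).
  rewrite ltr_pdivrMr ?exprn_gt0// -ltr_pdivrMl// mulrC.
  apply: lt_trans (archi_boundP (divr_ge0 (ltW ab0) (ltW d0))) _.
  by rewrite -natrX ltr_nat ltn_expl.
apply: (Tbad n); exists 0%N => k _; rewrite T1.
set eta := e * (a * b) / (2 * (a + b) ^+ 2) * ((a + b) / 2 ^+ n).
apply: le_trans (@bsum_affine R h _ _ _ _ _ (h (cpt X Y)) L (cpt X Y) eta _ _ _ _) _.
- by rewrite expn_gt0.
- exact/ltW/p0.
- exact/ltW/p0.
- move=> x' y' x'P y'P.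
  have dist : cmod (cpt x' y' - cpt X Y) <= (a + b) / 2 ^+ n.
    apply: le_trans (cmod_le_ReIm _) _ => /=; rewrite mulrDl lerD//.
      have /andP[??] := XP n; have /andP[??] := x'P.
      by rewrite ler_norml; apply/andP; split; rewrite /a_ in x'P *; lra.
    have /andP[??] := YP n; have /andP[??] := y'P.
    by rewrite ler_norml; apply/andP; split; rewrite /b_ in y'P *; lra.
  apply: le_trans (dP _ (le_lt_trans dist nd)) _.
  by rewrite ler_wpM2l// ltW.
rewrite /eta /a_ /b_ le_eqVlt; apply/orP; left; apply/eqP; field.
by rewrite !gt_eqF ?exprn_gt0.
Qed.

End Goursat_bisection.

(** * Mean values and the maximum principle *)

Section Complex_exponential.
Context {R : realType}.
Local Notation C := (Cplx R).
Implicit Types (z w : C) (x y a b e : R).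

Definition cexp z : C :=
  (expR (complex.Re z) * cos (complex.Im z) +i*
   (expR (complex.Re z) * sin (complex.Im z)))%C.

Lemma cexpD z w : cexp (z + w) = cexp z * cexp w.
Proof.
case: z => x y; case: w => x' y'; rewrite /cexp /= expRD cosD sinD.
by apply/eqP; rewrite eq_complex /=; apply/andP; split; apply/eqP; ring.
Qed.

Lemma cmod_cexp x y : cmod (cexp (cpt x y)) = expR x.
Proof.
rewrite /cmod /cexp /= !exprMn -mulrDr cos2Dsin2 mulr1 sqrtr_sqr.
by rewrite ger0_norm ?expR_ge0.
Qed.

Lemma is_derive_first_order (f : R -> R) (x l : R) : is_derive x 1 f l ->
  forall e, 0 < e -> exists2 d, 0 < d & forall t, `|t| < d ->
    `|f (t + x) - f x - l * t| <= e * `|t|.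
Proof.
move=> [fd <-] e e0; set l' := 'D_1 f x.
have /cvgrPdist_le /(_ _ e0) :
  h^-1 *: ((f \o shift x) (h *: 1) - f x) @[h --> 0^'] --> (l' : R) := fd.
rewrite /prop_near1 /dnbhs /within /= => /nbhs_ballP[d /= d0 dP].
exists d => // t td; have [->|t0] := eqVneq t 0.
  by rewrite add0r subrr mulr0 subrr normr0 mulr0.
have := dP t; rewrite -ball_normE /= sub0r normrN => /(_ td t0).
rewrite [_ *: 1]mulr1 -(ler_pM2r (_ : 0 < `|t|)) ?normr_gt0// -normrM.
by rewrite mulrBl [_ *: _]mulrC divfK// distrC.
Qed.

Lemma cexp_first_order e : 0 < e -> exists2 d, 0 < d &
  forall z, cmod z < d -> cmod (cexp z - 1 - z) <= e * cmod z.
Proof.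
(* The four error terms below are at most 1, 3, 3 and 2 times [eta * q], and 16 exceeds their sum.
   The bound eta <= 1 serves to keep the real exponential below 3. *)
move=> e0; pose eta := Num.min 1 (e / 16).
have eta0 : 0 < eta by rewrite lt_min ltr01 divr_gt0.
have eta1 : eta <= 1 by rewrite ge_min lexx.
have etae : 16 * eta <= e by rewrite -ler_pdivlMl// mulrC ge_min lexx orbT.
clearbody eta.
have [d1 d10 d1P] := is_derive_first_order (is_derive_expR 0) eta0.
have [d2 d20 d2P] := is_derive_first_order (is_derive_cos 0) eta0.
have [d3 d30 d3P] := is_derive_first_order (is_derive_sin 0) eta0.
exists (Num.min eta (Num.min d1 (Num.min d2 d3))).
  by rewrite !lt_min eta0 d10 d20.
move=> z; rewrite !lt_min => /and4P[q0 q1 q2 q3].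
have := Im_le_cmod z; have := Re_le_cmod z.
have [q qE] : exists q, q = cmod z by exists (cmod z).
rewrite -qE in q0 q1 q2 q3 *; have q_ge0 : 0 <= q by rewrite qE cmod_ge0.
case: z {qE} => x y xq yq; rewrite /= in xq yq.
have := d1P x (le_lt_trans xq q1); have := d2P y (le_lt_trans yq q2).
have := d3P y (le_lt_trans yq q3) => S3 S2 S1.
rewrite addr0 sin0 cos0 mul1r subr0 in S3.
rewrite addr0 sin0 cos0 oppr0 mul0r subr0 in S2.
rewrite addr0 expR0 mul1r in S1.
apply: le_trans (cmod_le_ReIm _) _ => /=; rewrite subr0.
set ex := expR x in S1 *; set cy := cos y in S2 *; set sy := sin y in S3 *.
have A4 : `|ex - 1 - x| <= eta * q by apply: le_trans S1 _; rewrite ler_pM2l.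
have ex3 : `|ex| <= 3.
  have -> : ex = (ex - 1 - x) + (1 + x) by ring.
  rewrite (le_trans (ler_normD _ _))//.
  have := ler_normD 1 x; rewrite normr1; nra.
have -> : ex * cy - 1 - x = (ex - 1 - x) + ex * (cy - 1) by ring.
have -> : ex * sy - y = ex * (sy - y) + ((ex - 1 - x) + x) * y by ring.
have H1 := ler_normD (ex - 1 - x) (ex * (cy - 1)).
have H2 := ler_normD (ex * (sy - y)) ((ex - 1 - x + x) * y).
have H3 := ler_normD (ex - 1 - x) x.
rewrite !normrM in H1 H2.
have A1 : `|ex| * `|cy - 1| <= 3 * (eta * q).
  by apply: ler_pM => //; apply: le_trans S2 _; rewrite ler_pM2l.
have A2 : `|ex| * `|sy - y| <= 3 * (eta * q).
  by apply: ler_pM => //; apply: le_trans S3 _; rewrite ler_pM2l.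
have A3 : `|ex - 1 - x + x| * `|y| <= (2 * eta) * q.
  apply: ler_pM => //; apply: le_trans H3 _; nra.
have A5 := mulr_ge0 (ltW eta0) q_ge0.
have A6 : 16 * eta * q <= e * q by rewrite ler_wpM2r.
lra.
Qed.

Lemma derivable_cexp z : derivable cexp z 1.
Proof.
apply/derivable_cmodP; exists (cexp z) => e e0.
set m := cmod (cexp z); have m0 : 0 <= m by exact: cmod_ge0.
have [d d0 dP] := cexp_first_order (divr_gt0 e0 (ltr_wpDl m0 ltr01)).
exists d => // w /dP wz.
have -> : cexp w - cexp z - cexp z * (w - z) = cexp z * (cexp (w - z) - 1 - (w - z)).
  have -> : cexp w = cexp (w - z) * cexp z by rewrite -cexpD subrK.
  ring.
rewrite cmodM -/m (le_trans (ler_wpM2l m0 wz))// mulrA ler_wpM2r ?cmod_ge0//.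
rewrite mulrA ler_pdivrMr ?ltr_wpDl//; nra.
Qed.

End Complex_exponential.

Section Maximum_principle.
Context {R : realType}.
Local Notation C := (Cplx R).
Implicit Types (z w c : C) (x y a b e rho M : R) (g h : C -> C).

(** In exponential coordinates a mean over a circle is a vertical sum of [g (c + cexp w)], to which
    the rectangle theorem applies. *)
Definition circle_pt c rho t : C := c + cexp (cpt (ln rho) t).

Lemma circle_ptB c rho t : 0 < rho -> cmod (circle_pt c rho t - c) = rho.
Proof. by move=> rho0; rewrite /circle_pt addrC addKr cmod_cexp lnK. Qed.

Lemma circle_pt0 c rho : 0 < rho -> circle_pt c rho 0 = c + rho%:C%C.
Proof.
by move=> rho0; rewrite /circle_pt /cexp /= cos0 sin0 lnK// mulr0 mulr1.
Qed.

Lemma derivable_circle g c z : derivable g (c + cexp z) 1 ->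
  derivable (fun w : C => g (c + cexp w)) z 1.
Proof.
move=> gd; pose h (w : C) : C := c + cexp w.
have hd : derivable h z 1.
  by apply: derivable1D; [exact: derivable1_cst|exact: derivable_cexp].
exact: (@derivable1_comp _ h g z hd gd).
Qed.

Definition circle_mean g c rho (n : nat) : C :=
  n%:R^-1 * \sum_(j < n) g (circle_pt c rho (j%:R * (2 * pi / n%:R))).

(** In the rectangle with real part from [ln rho1] to [ln rho] and imaginary part from 0 to 2 pi,
    the horizontal sides cancel by periodicity, so the means over the two circles are eventually
    close. The inner circle is so small that g is within e/2 of [g c] on it. *)
Lemma circle_mean_cvg g c rho e : 0 < rho -> 0 < e ->
  (forall z, cmod (z - c) <= rho -> derivable g z 1) ->
  exists N, forall k, (N <= k)%N ->
    cmod (g c - circle_mean g c rho (2 ^ k)) <= e.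
Proof.
move=> rho0 e0 gd; have e20 : 0 < e / 2 by rewrite divr_gt0.
have [d d0 dP] : exists2 d : R, 0 < d &
    forall w, cmod (w - c) < d -> cmod (g w - g c) < e / 2.
  by apply: derivable_cmod_cts => //; apply: gd; rewrite subrr cmod0 ltW.
pose rho1 := Num.min d rho / 2.
have m0 : 0 < Num.min d rho by rewrite lt_min d0.
have rho10 : 0 < rho1 by rewrite divr_gt0.
have rho1d : rho1 < d.
  by rewrite (@lt_le_trans _ _ (Num.min d rho))// ?ge_min ?lexx// /rho1; lra.
have rho1r : rho1 < rho.
  by rewrite (@lt_le_trans _ _ (Num.min d rho))// ?ge_min ?lexx ?orbT// /rho1; lra.
have ln_lt : ln rho1 < ln rho by rewrite ltr_ln.
pose a := ln rho - ln rho1; have a0 : 0 < a by rewrite subr_gt0.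
have pi20 : 0 < 2 * pi :> R by rewrite mulr_gt0// pi_gt0.
pose h w := g (c + cexp w).
have hd x' y' : ln rho1 <= x' <= ln rho1 + a -> 0 <= y' <= 0 + 2 * pi ->
    derivable h (cpt x' y') 1.
  move=> /andP[_ x'a] _; apply: derivable_circle; apply: gd.
  rewrite addrC addKr cmod_cexp -ler_ln ?posrE ?expR_gt0// expRK.
  by rewrite (le_trans x'a)// /a addrC subrK.
have e'0 : 0 < e / 2 / a by rewrite divr_gt0.
have [N NP] := goursat_rectangle a0 pi20 e'0 hd.
exists N => k /NP; set n := (2 ^ k)%N.
have n0 : (0 < n)%N by rewrite expn_gt0.
have nC : n%:R != 0 :> C by rewrite pnatr_eq0 -lt0n.
have -> : bsum h n (ln rho1) 0 a (2 * pi) = vsum h n (ln rho) 0 (2 * pi) -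
    vsum h n (ln rho1) 0 (2 * pi).
  rewrite /bsum /a [ln rho1 + _]addrC subrK.
  suff -> : hsum h n (ln rho1) (0 + 2 * pi) a = hsum h n (ln rho1) 0 a.
    by rewrite /a subrr add0r.
  rewrite /hsum; congr (_ * _); apply: eq_bigr => j _; congr (g (c + _)).
  by rewrite /cexp /= add0r (mulr_natl pi 2) cos2pi sin2pi cos0 sin0.
have vE r' : vsum h n (ln r') 0 (2 * pi) =
    'i%C * (2 * pi)%:C%C * circle_mean g c r' n.
  rewrite /vsum /circle_mean rmorphM fmorphV rmorph_nat !mulrA.
  by congr (_ * _); apply: eq_bigr => j _; rewrite /h /circle_pt add0r.
rewrite !vE -mulrBr !cmodM.
have -> : cmod ('i%C : C) = 1 by rewrite /cmod /= expr0n expr1n /= add0r sqrtr1.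
rewrite mul1r cmodR ger0_norm; last exact: ltW.
have -> : e / 2 / a * (a * (2 * pi)) = 2 * pi * (e / 2).
  by field; rewrite gt_eqF.
rewrite ler_pM2l// => meanE.
have mean1 : cmod (g c - circle_mean g c rho1 n) <= e / 2.
  have -> : g c - circle_mean g c rho1 n = n%:R^-1 *
      \sum_(j < n) (g c - g (circle_pt c rho1 (j%:R * (2 * pi / n%:R)))).
    by rewrite sumrB mulrBr sumr_const card_ord -[g c *+ n]mulr_natl mulKf.
  rewrite cmodM cmodV -[n%:R]/((n%:R : R[i])).
  rewrite -(rmorph_nat (real_complex R)) cmodR.
  rewrite ger0_norm// ler_pdivrMl ?ltr0n//.
  rewrite -[n in leRHS]card_ord -sum1_card natr_sum mulr_suml.
  elim/big_ind2 : _ => [|u u' v v' uv uv'|j _]; first by rewrite cmod0.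
    by rewrite (le_trans (cmodD _ _))// lerD.
  by rewrite mul1r cmodB ltW// dP// circle_ptB.
rewrite (le_trans (cmod_dist _ _ (circle_mean g c rho1 n)))//.
by rewrite (splitr e) lerD// cmodB.
Qed.

(** If |g| fell short of M by 2 eta at this point, it would be at most M - eta on the arc of
    parameters below d. That arc contains the first 2^-k0 of the nodes, so every fine mean would
    stay below M by eta / 2^k0, although the means converge to [g c]. *)
Lemma max_on_circle g c rho M : 0 < rho ->
  (forall z, cmod (z - c) <= rho -> derivable g z 1) ->
  (forall z, cmod (z - c) <= rho -> cmod (g z) <= M) ->
  cmod (g c) = M -> cmod (g (c + rho%:C%C)) = M.
Proof.
move=> rho0 gd gM gcM; apply/eqP; rewrite eq_le gM/=; last first.
  by rewrite addrC addKr cmodR ger0_norm// ltW.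
rewrite leNgt; apply/negP => ltM.
pose eta := (M - cmod (g (c + rho%:C%C))) / 2.
have eta0 : 0 < eta by rewrite divr_gt0// subr_gt0.
pose h w := g (c + cexp w).
have hd : derivable h (cpt (ln rho) 0) 1.
  by apply: derivable_circle; apply: gd; rewrite circle_ptB.
have [d d0 dP] := derivable_cmod_cts hd eta0.
have pi20 : 0 < 2 * pi :> R by rewrite mulr_gt0// pi_gt0.
have hsmall t : `|t| < d -> cmod (g (circle_pt c rho t)) <= M - eta.
  move=> td; have := dP (cpt (ln rho) t); rewrite cptB subrr subr0.
  have -> : cmod (cpt 0 t) = `|t| by rewrite /cmod /= expr0n add0r sqrtr_sqr.
  move=> /(_ td); rewrite /h -/(circle_pt c rho t) -/(circle_pt c rho 0).
  rewrite circle_pt0// => ht.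
  have := cmod_leB (g (circle_pt c rho t)) (g (c + rho%:C%C)).
  by move: ht; rewrite /eta; lra.
have [k0 k0d] : exists k0, 2 * pi / 2 ^+ k0 < d.
  exists (Num.bound ((2 * pi) / d)).
  rewrite ltr_pdivrMr ?exprn_gt0// -ltr_pdivrMl// mulrC.
  apply: lt_trans (archi_boundP (divr_ge0 (ltW pi20) (ltW d0))) _.
  by rewrite -natrX ltr_nat ltn_expl.
have e0 : 0 < eta / 2 ^+ k0 / 2.
  by apply: divr_gt0 => //; apply: divr_gt0 => //; rewrite exprn_gt0.
have [N NP] := circle_mean_cvg rho0 e0 gd.
have := NP (N + k0)%N (leq_addr _ _).
set n := (2 ^ _)%N; set m := (2 ^ N)%N => meanE.
have mn : n = (m * 2 ^ k0)%N by rewrite /n expnD.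
have n0 : 0 < n%:R :> R by rewrite ltr0n expn_gt0.
have m0 : 0 < m%:R :> R by rewrite ltr0n expn_gt0.
have len : (m <= n)%N by rewrite mn leq_pmulr// expn_gt0.
have mean2 : cmod (circle_mean g c rho n) <= M - eta / 2 ^+ k0.
  rewrite cmodM cmodV -[n%:R]/((n%:R : R[i])).
  rewrite -(rmorph_nat (real_complex R)) cmodR.
  rewrite ger0_norm// ler_pdivrMl//.
  have -> : n%:R * (M - eta / 2 ^+ k0) = n%:R * M - m%:R * eta.
    rewrite mn natrM natrX; field.
    by rewrite expf_neq0.
  have -> : m%:R * eta = \sum_(j < n) (if (j < m)%N then eta else 0).
    rewrite -big_mkcond -(big_ord_widen n (fun=> eta) len) sumr_const card_ord.
    by rewrite mulr_natl.
  have -> : n%:R * M = \sum_(j < n) M by rewrite sumr_const card_ord mulr_natl.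
  rewrite -sumrB.
  elim/big_ind2 : _ => [|u u' v v' uv uv'|j _]; first by rewrite cmod0.
    by rewrite (le_trans (cmodD _ _))// lerD.
  case: ifPn => jm; last by rewrite subr0 gM// circle_ptB.
  have p0 : 0 < 2 ^+ k0 :> R by rewrite exprn_gt0.
  apply: hsmall; rewrite ger0_norm; last first.
    by apply: mulr_ge0 => //; apply: divr_ge0 => //; exact: ltW.
  apply: le_lt_trans k0d.
  have -> : n%:R = m%:R * 2 ^+ k0 :> R by rewrite mn natrM natrX.
  have -> : j%:R * (2 * pi / (m%:R * 2 ^+ k0)) = j%:R / m%:R * (2 * pi / 2 ^+ k0) :> R.
    by field; rewrite !gt_eqF.
  rewrite ler_piMl//; first by apply: divr_ge0; exact: ltW.
  by rewrite ler_pdivrMr// mul1r ler_nat ltnW.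
have := cmod_leB (g c) (circle_mean g c rho n); rewrite gcM.
have : 0 < eta / 2 ^+ k0 by apply: divr_gt0 => //; rewrite exprn_gt0.
move: meanE mean2; lra.
Qed.

(* At the rightmost point where |g| is maximal the mean value property fails. *)
Theorem max_principle (Omega : set C) g B M :
  open Omega -> (forall z, Omega z -> cmod z <= B) ->
  (forall z, closure Omega z -> derivable g z 1) ->
  (forall z, closure Omega z -> ~ Omega z -> cmod (g z) <= M) ->
  forall z, Omega z -> cmod (g z) <= M.
Proof.
move=> oO OB gd gM z0 Oz0; rewrite leNgt; apply/negP => Mz0.
have cB z : closure Omega z -> cmod z <= B by exact: cmod_closure_le.
have ccl : closed (closure Omega) by exact: closed_closure.
have gc z (e : R) : closure Omega z -> 0 < e -> exists2 d : R, 0 < d &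
    forall w, cmod (w - z) < d -> `|cmod (g w) - cmod (g z)| < e.
  by move=> /gd; exact: cmod_derivable_cts.
have [|z1 cz1 z1max] := evt_max (phi := fun z => cmod (g z)) ccl cB
  (ex_intro _ z0 (subset_closure Oz0)).
  by move=> z cz e /(gc z e cz)[d d0 dP]; exists d => // w _; exact: dP.
rewrite /= in z1max; set S := cmod (g z1) in z1max.
have MS : M < S := lt_le_trans Mz0 (z1max z0 (subset_closure Oz0)).
pose K := [set z | closure Omega z /\ cmod (g z) = S].
have cK : closed K.
  move=> z /closure_cmodP Kz.
  have cz : closure Omega z.
    apply: ccl; apply/closure_cmodP => d d0.
    by have [w [cw _] wz] := Kz d d0; exists w.
  split => //; apply/eqP; rewrite -subr_eq0 -normr_eq0 eq_le normr_ge0 andbT.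
  apply/ler_addgt0Pl => e e0; have [d d0 dP] := gc z e cz e0; rewrite addr0.
  by have [w [_ <-] wz] := Kz d d0; rewrite distrC ltW// dP.
have [|z2 [cz2 gz2] z2max] := evt_max (phi := fun z : C => complex.Re z) cK
    (fun z (Kz : K z) => cB z Kz.1) (ex_intro _ z1 (conj cz1 erefl)).
  move=> z _ e e0; exists e => // w _ wz.
  by rewrite -raddfB (le_lt_trans (Re_le_cmod _)).
have Oz2 : Omega z2.
  by apply: contrapT => /(gM _ cz2); rewrite gz2 leNgt MS.
rewrite /= in z2max.
have /open_cmodP/(_ _ Oz2)[d d0 dP] := oO.
have rho0 : 0 < d / 2 by rewrite divr_gt0.
have sub z : cmod (z - z2) <= d / 2 -> Omega z.
  by move=> zz2; apply: dP; rewrite (le_lt_trans zz2)//; lra.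
have inK : K (z2 + (d / 2)%:C%C).
  have cz : closure Omega (z2 + (d / 2)%:C%C).
    by apply/subset_closure/sub; rewrite addrC addKr cmodR ger0_norm// ltW.
  split => //; apply: max_on_circle rho0 _ _ gz2 => z /sub Oz.
    by apply/gd/subset_closure.
  by apply/z1max/subset_closure.
have := z2max _ inK; rewrite raddfD /=; lra.
Qed.

End Maximum_principle.

(** * Schwarz lemma, open mapping and Montel's theorem *)

Section Schwarz.
Context {R : realType}.
Local Notation C := (Cplx R).
Implicit Types (z w c : C) (e rho M B : R) (g h F : C -> C) (s : seq C).

Definition disc c rho : set C := [set z | cmod (z - c) < rho].

Lemma disc_open c rho : open (disc c rho).
Proof.
apply/open_cmodP => z zc; exists (rho - cmod (z - c)); first by rewrite subr_gt0.
move=> w wz; rewrite /disc /=.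
by rewrite (le_lt_trans (cmod_dist _ _ z))// -ltrBrDr.
Qed.

Lemma closure_disc c rho z : closure (disc c rho) z -> cmod (z - c) <= rho.
Proof.
move=> /closure_cmodP dz; apply/ler_addgt0Pl => e /dz[w wc wz].
rewrite /disc /= in wc.
by rewrite (le_trans (cmod_dist _ _ w))// cmodB lerD// ltW.
Qed.

Lemma disc_bounded c rho z : cmod (z - c) <= rho -> cmod z <= rho + cmod c.
Proof. by have := cmod_leB z c; lra. Qed.

Lemma closed_cdisc c rho : closed [set z | cmod (z - c) <= rho].
Proof.
move=> z /closure_cmodP dz; apply/ler_addgt0Pl => e /dz[w wc wz].
rewrite /= in wc.
by rewrite (le_trans (cmod_dist _ _ w))// cmodB lerD// ltW.
Qed.

Lemma derivable_bounded_near g z : derivable g z 1 ->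
  exists2 d : R, 0 < d & forall w, cmod (w - z) < d -> cmod (g w) <= cmod (g z) + 1.
Proof.
move=> /cmod_derivable_cts /(_ ltr01)[d d0 dP]; exists d => // w /dP.
by rewrite ltr_norml; lra.
Qed.

Lemma pow_unbounded (x A : R) : 1 < x -> exists k, A < x ^+ k.
Proof.
move=> x1.
have bern k : 1 + k%:R * (x - 1) <= x ^+ k.
  elim: k => [|k IH]; first by rewrite mul0r addr0 expr0.
  have x0 : 0 <= x by lra.
  rewrite exprS (le_trans _ (ler_wpM2l x0 IH))// -subr_ge0 -natr1.
  rewrite (_ : _ - _ = k%:R * (x - 1) ^+ 2); last by ring.
  by rewrite mulr_ge0// sqr_ge0.
exists (Num.bound (`|A| / (x - 1))); apply: lt_le_trans (bern _).
have x10 : 0 < x - 1 by rewrite subr_gt0.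
have := archi_boundP (divr_ge0 (normr_ge0 A) (ltW x10)).
by rewrite ltr_pdivrMr// => Ak; have := ler_norm A; lra.
Qed.

Lemma derivable_factor (a z : C) : derivable (fun w : C => w - a) z 1.
Proof. by apply: derivable1D; [exact: derivable1_id|exact: derivable1_cst]. Qed.

Lemma derivable_pow g z k : derivable g z 1 ->
  derivable (fun w : C => g w ^+ k) z 1.
Proof.
move=> gz; elim: k => [|k IH]; first exact: derivable1_cst.
under eq_fun do rewrite exprS; exact: derivable1M.
Qed.

Lemma derivable_prod_pow s k z :
  derivable (fun w : C => \prod_(a <- s) (w - a) ^+ k) z 1.
Proof.
elim: s => [|a s IH].
  under eq_fun do rewrite big_nil; exact: derivable1_cst.
under eq_fun do rewrite big_cons.
by apply: derivable1M IH; apply: derivable_pow; exact: derivable_factor.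
Qed.

Lemma cmod_prod s (g : C -> C) : cmod (\prod_(a <- s) g a) = \prod_(a <- s) cmod (g a).
Proof.
by elim: s => [|a s IH]; rewrite ?big_nil ?cmod1// !big_cons cmodM IH.
Qed.

Lemma prod_cst_seq s (x : R) : \prod_(a <- s) x = x ^+ size s.
Proof. by elim: s => [|a s IH]; rewrite ?big_nil// big_cons IH -exprS. Qed.

(* Isolated points where g is merely bounded are harmless: the maximum principle
   applies to g^k \prod (z - a)^2, and the k-th root removes the extra factor. *)
Lemma max_principle_except (Omega : set C) g B M s :
  open Omega -> (forall z, Omega z -> cmod z <= B) -> 0 <= M ->
  (forall a, a \in s -> Omega a) ->
  (forall z, closure Omega z -> z \notin s -> derivable g z 1) ->
  (forall a, a \in s -> exists K : R, exists2 d : R, 0 < d &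
     forall w, cmod (w - a) < d -> cmod (g w) <= K) ->
  (forall z, closure Omega z -> ~ Omega z -> cmod (g z) <= M) ->
  forall z, Omega z -> z \notin s -> cmod (g z) <= M.
Proof.
move=> oO OB M0 sO gd gs gM z0 Oz0 z0s; rewrite leNgt; apply/negP => Mz0.
pose P z : C := \prod_(a <- s) (z - a) ^+ 2.
have Pd z : derivable P z 1 by exact: derivable_prod_pow.
have cB z : closure Omega z -> cmod z <= B by exact: cmod_closure_le.
have [|c _ cmax] := evt_max (phi := fun z => cmod (P z)) (@closed_closure _ Omega) cB
  (ex_intro _ z0 (subset_closure Oz0)).
  move=> z _ e e0; have [d d0 dP] := cmod_derivable_cts (Pd z) e0.
  by exists d => // w _; exact: dP.
set Bp := cmod (P c) in cmax.
have Pz0 : 0 < cmod (P z0).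
  rewrite cmod_gt0 /P prodf_seq_neq0; apply/allP => a sa /=.
  by rewrite expf_neq0// subr_eq0; apply: contraNneq z0s => ->.
have Gd k z : closure Omega z -> derivable (fun w => g w ^+ k * P w) z 1.
  move=> cz; have [zs|zs] := boolP (z \in s); last first.
    by apply: (derivable1M _ (Pd z)); apply: derivable_pow; exact: gd.
  have [K [d d0 dK]] := gs z zs.
  pose P' w : C := \prod_(a <- rem z s) (w - a) ^+ 2.
  have PE w : P w = (w - z) ^+ 2 * P' w.
    by rewrite /P (perm_big _ (perm_to_rem zs)) big_cons.
  have [d' d'0 dP'] := derivable_bounded_near (@derivable_prod_pow (rem z s) 2 z).
  set K' := _ + 1 in dP'.
  have K'0 : 0 < K' by rewrite ltr_wpDl// cmod_ge0.
  have K0 : 0 <= K by rewrite (le_trans (cmod_ge0 (g z)))// dK// subrr cmod0.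
  (* Near z the product is at most K^k K' |w - z|^2, hence differentiable with derivative 0; this is
     the purpose of squaring the factors. *)
  apply/derivable_cmodP; exists 0 => e e0.
  have KK : 0 < K ^+ k * K' + 1 by rewrite ltr_wpDl// mulr_ge0 ?exprn_ge0// ltW.
  exists (Num.min (Num.min d d') (e / (K ^+ k * K' + 1))).
    by rewrite !lt_min d0 d'0 divr_gt0.
  move=> w; rewrite !lt_min => /andP[/andP[wd wd'] we].
  rewrite (PE z) subrr expr0n /= mul0r mulr0 subr0 mul0r subr0 PE.
  rewrite !cmodM !cmodX; set x := cmod (w - z) in wd wd' we *.
  have x0 : 0 <= x by exact: cmod_ge0.
  have gk : cmod (g w) ^+ k <= K ^+ k by rewrite lerXn2r ?nnegrE ?cmod_ge0// dK.
  have H : cmod (g w) ^+ k * cmod (P' w) <= K ^+ k * K'.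
    by apply: ler_pM; rewrite ?exprn_ge0 ?cmod_ge0// dP'.
  rewrite ltr_pdivlMr// in we.
  have -> : cmod (g w) ^+ k * (x ^+ 2 * cmod (P' w)) =
    (cmod (g w) ^+ k * cmod (P' w)) * x * x by ring.
  rewrite ler_wpM2r//; apply: le_trans (ler_wpM2r x0 H) _; nra.
have Gb k : cmod (g z0) ^+ k * cmod (P z0) <= M ^+ k * Bp.
  rewrite -cmodX -cmodM.
  apply: (@max_principle R Omega (fun w => g w ^+ k * P w) B _ oO OB (Gd k) _ z0 Oz0).
  move=> z cz Oz; rewrite cmodM cmodX; apply: ler_pM; rewrite ?exprn_ge0 ?cmod_ge0//.
    by rewrite lerXn2r ?nnegrE ?cmod_ge0// gM.
  exact: cmax.
set q := cmod (g z0) in Mz0 Gb.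
(* M may be 0, so the growing ratio is formed with the midpoint, which is positive. *)
pose M' := (M + q) / 2.
have M'0 : 0 < M' by rewrite /M'; lra.
have M'q : 1 < q / M' by rewrite ltr_pdivlMr// mul1r /M'; lra.
have [k kP] := pow_unbounded (Bp / cmod (P z0)) M'q.
rewrite ltr_pdivrMr// expr_div_n mulrAC ltr_pdivlMr ?exprn_gt0// in kP.
have MM' : M <= M' by rewrite /M'; lra.
have := Gb k; have : M ^+ k * Bp <= M' ^+ k * Bp.
  apply: ler_wpM2r; first exact: cmod_ge0.
  by apply: lerXn2r => //; rewrite nnegrE// ltW.
by move: kP; rewrite [Bp * _]mulrC; lra.
Qed.

Lemma quotient_bounded_near F a : derivable F a 1 -> F a = 0 ->
  exists K : R, exists2 d : R, 0 < d &
    forall w, cmod (w - a) < d -> cmod (F w / (w - a)) <= K.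
Proof.
move=> /derivable_cmodP[L LP] Fa; have [d d0 dP] := LP 1 ltr01.
exists (1 + cmod L), d => // w /dP; rewrite Fa subr0 mul1r => FL.
have [->|wa] := eqVneq w a; first by rewrite Fa mul0r cmod0 addr_ge0// cmod_ge0.
rewrite cmodM cmodV ler_pdivrMr ?cmod_gt0 ?subr_eq0// mulrDl mul1r -cmodM.
by have := cmod_leB (F w) (L * (w - a)); lra.
Qed.

Lemma derivable_quotient F (Q : C -> C) z : derivable F z 1 -> derivable Q z 1 ->
  Q z != 0 -> derivable (fun w => F w / Q w) z 1.
Proof. by move=> Fz Qz Q0; apply: (derivable1M Fz); exact: derivable1V. Qed.

(** The maximum principle for the difference quotient (g z - g c) / (z - c), with the centre as
    exceptional point: on the circle it is at most 2M / rho. *)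
Lemma schwarz_lipschitz g c rho M : 0 < rho ->
  (forall z, cmod (z - c) <= rho -> derivable g z 1) ->
  (forall z, cmod (z - c) <= rho -> cmod (g z) <= M) ->
  forall w, cmod (w - c) < rho -> cmod (g w - g c) <= 2 * M / rho * cmod (w - c).
Proof.
move=> rho0 gd gM w wc; have [->|wNc] := eqVneq w c.
  by rewrite !subrr cmod0 mulr0.
have cc : cmod (c - c) <= rho by rewrite subrr cmod0 ltW.
have M0 : 0 <= M by rewrite (le_trans (cmod_ge0 (g c)))// gM.
pose G z := g z - g c.
have Gd z : cmod (z - c) <= rho -> derivable G z 1.
  by move=> zc; apply: derivable1D; [exact: gd|exact: derivable1_cst].
have Gle z : cmod (z - c) <= rho -> cmod (G z) <= 2 * M.
  move=> zc; rewrite (le_trans (cmodD _ _))// cmodN.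
  by have := gM z zc; have := gM c cc; lra.
have wc0 : 0 < cmod (w - c) by rewrite cmod_gt0 subr_eq0.
rewrite -ler_pdivrMr// -cmodV -cmodM.
apply: (@max_principle_except (disc c rho) (fun z => G z / (z - c)) (rho + cmod c)
  (2 * M / rho) [:: c]).
- exact: disc_open.
- by move=> z /ltW; exact: disc_bounded.
- by rewrite divr_ge0 ?mulr_ge0// ltW.
- by move=> a; rewrite inE => /eqP ->; rewrite /disc /= subrr cmod0.
- move=> z /closure_disc zc; rewrite inE => zNc; apply: derivable_quotient.
  + exact: Gd.
  + exact: derivable_factor.
  + by rewrite subr_eq0.
- move=> a; rewrite inE => /eqP ->; apply: quotient_bounded_near; first exact: Gd.
  by rewrite /G subrr.
- move=> z /closure_disc zc /negP; rewrite -leNgt => zc'.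
  have -> : rho = cmod (z - c) by apply/eqP; rewrite eq_le zc zc'.
  rewrite cmodM cmodV ler_wpM2r ?invr_ge0 ?cmod_ge0//; exact: Gle.
- exact: wc.
- by rewrite inE.
Qed.

(** Divide F by the product of the z - a. On the circle of radius r each factor is at least 3r/4, in
    the quarter disc at most r/2, so each zero gains a factor 2/3. With arbitrarily many zeros this
    acts as an identity theorem. *)
Lemma zeros_bound F c r M s : 0 < r -> uniq s ->
  (forall z, cmod (z - c) <= r -> derivable F z 1) ->
  (forall z, cmod (z - c) <= r -> cmod (F z) <= M) ->
  (forall a, a \in s -> F a = 0 /\ cmod (a - c) <= r / 4) ->
  forall z, cmod (z - c) <= r / 4 -> cmod (F z) <= M * (2 / 3) ^+ size s.
Proof.
move=> r0 us Fd FM Fs z zc.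
have M0 : 0 <= M.
  by rewrite (le_trans (cmod_ge0 (F c)))// FM// subrr cmod0 ltW.
have [zs|zs] := boolP (z \in s).
  by rewrite (Fs z zs).1 cmod0 mulr_ge0// exprn_ge0.
(* The exponent 1 matches the form of [derivable_prod_pow]. *)
pose Q w : C := \prod_(a <- s) (w - a) ^+ 1.
have Qn0 w : w \notin s -> Q w != 0.
  move=> ws; rewrite prodf_seq_neq0; apply/allP => a sa /=.
  by rewrite expr1 subr_eq0; apply: contraNneq ws => ->.
have bndM : 0 <= M / (3 * r / 4) ^+ size s.
  by rewrite divr_ge0// exprn_ge0// divr_ge0// mulr_ge0// ltW.
have rr : r / 4 < r by lra.
have FQ : cmod (F z / Q z) <= M / (3 * r / 4) ^+ size s.
  apply: (@max_principle_except (disc c r) (fun z => F z / Q z) (r + cmod c) _ s).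
  - exact: disc_open.
  - by move=> w /ltW; exact: disc_bounded.
  - exact: bndM.
  - by move=> a /Fs[_ ar]; rewrite /disc /= (le_lt_trans ar).
  - move=> w /closure_disc wc ws; apply: derivable_quotient; first exact: Fd.
      exact: derivable_prod_pow.
    exact: Qn0.
  - move=> a sa; have [Fa ac] := Fs a sa.
    have [K [d d0 dK]] := quotient_bounded_near (Fd a (le_trans ac (ltW rr))) Fa.
    pose Q' w : C := \prod_(b <- rem a s) (w - b) ^+ 1.
    have QE w : Q w = (w - a) * Q' w.
      by rewrite /Q (perm_big _ (perm_to_rem sa)) big_cons expr1.
    have Q'd : derivable (fun w => (Q' w)^-1) a 1.
      apply: derivable1V; first exact: derivable_prod_pow.
      rewrite prodf_seq_neq0; apply/allP => b; rewrite mem_rem_uniq// inE => /andP[ba _].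
      by rewrite /= expr1 subr_eq0 eq_sym.
    have [d' d'0 dP'] := derivable_bounded_near Q'd.
    set K' := _ + 1 in dP'.
    exists (K * K'), (Num.min d d'); first by rewrite lt_min d0.
    move=> w; rewrite lt_min => /andP[wd wd'].
    rewrite QE invfM mulrA cmodM; apply: ler_pM; rewrite ?cmod_ge0//; first exact: dK.
    exact: dP'.
  - move=> w /closure_disc wc /negP; rewrite -leNgt => wc'.
    rewrite cmodM cmodV; apply: ler_pM; rewrite ?cmod_ge0 ?invr_ge0 ?cmod_ge0//.
      exact: FM.
    rewrite lef_pV2 ?posrE ?cmod_gt0; last 2 first.
    + apply: Qn0; apply/negP => /Fs[_ ws]; rewrite /= in wc'.
      by have := le_lt_trans ws rr; rewrite ltNge wc'.
    + by rewrite exprn_gt0// divr_gt0// mulr_gt0.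
    rewrite /Q cmod_prod -prod_cst_seq big_seq.
    rewrite [leRHS]big_seq; apply: ler_prod => a sa; rewrite expr1.
    have r34 : 0 <= 3 * r / 4 by rewrite divr_ge0// mulr_ge0// ltW.
    rewrite r34 /=.
    have [_ ac] := Fs a sa; have := cmod_dist w c a.
    by move: wc'; lra.
  - by rewrite /disc /= (le_lt_trans zc).
  - exact: zs.
have -> : F z = F z / Q z * Q z by rewrite divfK ?Qn0.
have -> : M * (2 / 3) ^+ size s = M / (3 * r / 4) ^+ size s * (r / 2) ^+ size s.
  rewrite -mulrA; congr (_ * _); rewrite [RHS]mulrC -expr_div_n; congr (_ ^+ _).
  by field; rewrite gt_eqF.
rewrite cmodM; apply: ler_pM; rewrite ?cmod_ge0//.
rewrite /Q cmod_prod -prod_cst_seq big_seq.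
rewrite [leRHS]big_seq; apply: ler_prod => a sa; rewrite expr1 cmod_ge0 /=.
have [_ ac] := Fs a sa; have := cmod_dist z a c; rewrite (cmodB c).
by move: zc; lra.
Qed.

End Schwarz.

(** * Isolated values and the open mapping theorem *)

Section Open_mapping.
Context {R : realType}.
Local Notation C := (Cplx R).
Implicit Types (z w c : C) (e rho M B : R) (f g : C -> C).

Lemma entire_bounded f B : entire f ->
  exists2 M : R, 0 <= M & forall z, cmod z <= B -> cmod (f z) <= M.
Proof.
move=> fE; have [B0|B0] := leP 0 B; last first.
  by exists 0 => // z zB; have := le_lt_trans zB B0; rewrite ltNge cmod_ge0.
have D0 : cmod ((0 : C) - 0) <= B by rewrite subr0 cmod0.
have [||c _ cmax] := evt_max (phi := fun z => cmod (f z)) (M := B)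
    (@closed_cdisc R 0 B) _ (ex_intro _ (0 : C) D0).
- by move=> z; rewrite /= subr0.
- move=> z _ e e0; have [d d0 dP] := cmod_derivable_cts (fE z) e0.
  by exists d => // w _; exact: dP.
exists (cmod (f c)); first exact: cmod_ge0.
by move=> z zB; apply: cmax; rewrite /= subr0.
Qed.

Lemma entire_lipschitz f B : entire f -> exists2 L : R, 0 <= L &
  forall z w, cmod z <= B -> cmod w <= B -> cmod (f z - f w) <= L * cmod (z - w).
Proof.
move=> fE; have [B0|B0] := leP 0 B; last first.
  by exists 0 => // z w zB; have := le_lt_trans zB B0; rewrite ltNge cmod_ge0.
(* Any two points of |z| <= B are less than 2B + 1 apart, so one Schwarz disc reaches them all. *)
have r0 : 0 < 2 * B + 1 by lra.
have [M M0 MP] := entire_bounded (B + (2 * B + 1)) fE.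
exists (2 * M / (2 * B + 1)).
  by apply: divr_ge0; [exact: mulr_ge0|exact: ltW].
move=> z w zB wB; apply: schwarz_lipschitz => //.
  move=> u uw; apply: MP; have := cmod_leB u w; lra.
have := cmodD z (- w); rewrite cmodN; lra.
Qed.

(** Otherwise each circle of radius e / (j + 2) carries a zero of f - f z0, and these infinitely
    many zeros force f z1 = f z0 through [zeros_bound]. *)
Lemma isolated_values f z0 z1 e : entire f -> f z1 != f z0 -> 0 < e ->
  exists2 rho, 0 < rho < e & forall z, cmod (z - z0) = rho -> f z != f z0.
Proof.
move=> fE f10 e0; apply: contrapT => noc.
have ex (j : nat) : exists z, cmod (z - z0) = e / j.+2%:R /\ f z = f z0.
  apply: contrapT => nz; apply: noc; exists (e / j.+2%:R).
    rewrite divr_gt0//= ltr_pdivrMr// -[ltLHS]mulr1 ltr_pM2l//.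
    by rewrite ltr1n.
  by move=> z zj; apply/eqP => fz; apply: nz; exists z.
have [a aP] := choice ex.
have a_inj : injective a.
  move=> i j aij; have [ai _] := aP i; have [aj _] := aP j.
  rewrite aij aj in ai; have /eqP := mulfI (lt0r_neq0 e0) ai.
  by rewrite (inj_eq invr_inj) eqr_nat => /eqP[].
pose F z := f z - f z0.
have FE : entire F by move=> z; apply: derivable1D; [exact: fE|exact: derivable1_cst].
(* Large enough for the quarter disc to contain z1 and all the zeros. *)
pose r := 4 * (e + cmod (z1 - z0)).
have z10 := cmod_ge0 (z1 - z0).
have r0 : 0 < r by rewrite /r; lra.
have [M M0 MP] := entire_bounded (r + cmod z0) FE.
have F1 n : cmod (F z1) <= M * (2 / 3) ^+ n.
  rewrite -[n in leRHS](size_iota 0) -(size_map a).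
  apply: (@zeros_bound R F z0 r M) => //.
  - by rewrite map_inj_uniq ?iota_uniq.
  - by move=> z /disc_bounded; exact: MP.
  - move=> b /mapP[j _ ->]; have [aj fj] := aP j; split.
      by rewrite /F fj subrr.
    rewrite aj; apply: (@le_trans _ _ e); last by rewrite /r; lra.
    by rewrite ler_pdivrMr// ler_peMr ?ler1n// ltW.
  - by rewrite /r; lra.
have F10 : 0 < cmod (F z1) by rewrite cmod_gt0 subr_eq0.
have [k kP] := @pow_unbounded R (3 / 2) (M / cmod (F z1)) ltac:(lra).
have := F1 k; rewrite ltr_pdivrMr// in kP.
rewrite (_ : 2 / 3 = (3 / 2)^-1 :> R); last by field.
rewrite exprVn ler_pdivlMr ?exprn_gt0 ?divr_gt0//.
by rewrite mulrC leNgt kP.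
Qed.

(** Let m be the minimum of |f - f z0| on a circle without the value f z0. If w with |w - f z0| <
    m/2 were missed inside, then 1 / (f - w) would be at most 2/m on the circle but larger at the
    centre. *)
Lemma open_mapping f z0 z1 e : entire f -> f z1 != f z0 -> 0 < e ->
  exists2 d, 0 < d & forall w, cmod (w - f z0) < d ->
    exists2 z, cmod (z - z0) < e & f z = w.
Proof.
move=> fE f10 e0; have [rho /andP[rho0 rhoe] rhoP] := isolated_values fE f10 e0.
pose A := [set z : C | cmod (z - z0) = rho].
have cA : closed A.
  move=> z /closure_cmodP Az; apply/eqP; rewrite -subr_eq0 -normr_eq0 eq_le.
  rewrite normr_ge0 andbT; apply/ler_addgt0Pl => d /Az[w wA wz]; rewrite addr0.
  rewrite /A /= in wA; rewrite ler_norml.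
  have := cmod_dist z z0 w; have := cmod_dist w z0 z.
  by rewrite (cmodB z w) wA; move: wz; lra.
have A0 : A (z0 + rho%:C%C) by rewrite /A /= addrC addKr cmodR ger0_norm// ltW.
pose F z := f z - f z0.
have FE z : derivable F z 1 by apply: derivable1D; [exact: fE|exact: derivable1_cst].
have [||c cc cmin] := evt_max (phi := fun z => - cmod (F z)) (M := rho + cmod z0)
    cA _ (ex_intro _ _ A0).
- by move=> z Az; apply: disc_bounded; rewrite Az.
- move=> z _ d d0; have [d' d'0 dP] := cmod_derivable_cts (FE z) d0.
  exists d' => // w _ /dP; rewrite -opprD normrN //.
set m := cmod (F c) in cmin.
have m0 : 0 < m by rewrite cmod_gt0 subr_eq0 rhoP.
clearbody m.
have Fm z : cmod (z - z0) = rho -> m <= cmod (F z).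
  by move=> /cmin /=; rewrite lerN2.
exists (m / 2); first by rewrite divr_gt0.
move=> w wm; apply: contrapT => noz.
have fw z : cmod (z - z0) <= rho -> f z - w != 0.
  move=> zr; apply/eqP => /eqP; rewrite subr_eq0 => /eqP fz; apply: noz.
  by exists z => //; exact: le_lt_trans zr rhoe.
have wf0 : 0 < cmod (f z0 - w) by rewrite cmod_gt0 fw// subrr cmod0 ltW.
have : cmod (f z0 - w)^-1 <= (m / 2)^-1.
  apply: (@max_principle R (disc z0 rho) (fun z => (f z - w)^-1) (rho + cmod z0)).
  - exact: disc_open.
  - by move=> z /ltW; exact: disc_bounded.
  - move=> z /closure_disc zr; apply: derivable1V; last exact: fw.
    by apply: derivable1D; [exact: fE|exact: derivable1_cst].
  - move=> z /closure_disc zr /negP; rewrite -leNgt => zr'.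
    have zrE : cmod (z - z0) = rho by apply/eqP; rewrite eq_le zr zr'.
    rewrite cmodV lef_pV2 ?posrE ?divr_gt0 ?cmod_gt0 ?fw//.
    have := Fm z zrE; have := cmod_dist (f z) (f z0) w; move: wm; rewrite /F; lra.
  - by rewrite /disc /= subrr cmod0.
by rewrite cmodV lef_pV2 ?posrE ?divr_gt0// cmodB leNgt wm.
Qed.

End Open_mapping.

(** * Normality of bounded families *)

Section Montel.
Context {R : realType}.
Local Notation C := (Cplx R).
Implicit Types (z w c : C) (e rho M B L : R) (f g : C -> C) (u : nat -> C).

Definition converges u l :=
  forall e, 0 < e -> exists N, forall k, (N <= k)%N -> cmod (u k - l) < e.

Lemma homo_ltn_ge (T : nat -> nat) k : {homo T : m n / (m < n)%N} -> (k <= T k)%N.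
Proof.
by move=> homoT; elim: k => // k IH; rewrite (leq_ltn_trans IH)// homoT.
Qed.

Lemma diagonal_extraction (u : nat -> nat -> C) B :
  (forall i k, cmod (u i k) <= B) ->
  exists2 phi : nat -> nat, {homo phi : m n / (m < n)%N} &
    forall i, exists l, converges (u i \o phi) l.
Proof.
move=> uB.
have ext (p : nat * (nat -> nat)) : exists psi : nat -> nat,
    {homo psi : m n / (m < n)%N} /\ exists l, converges (u p.1 \o p.2 \o psi) l.
  have [psi psi_incr [l lP]] := bolzano_weierstrass_cplx
    (fun k => uB p.1 (p.2 k)).
  by exists psi; split => //; exists l.
have [Psi PsiP] := choice ext.
pose S := fix S n := if n is n'.+1 then S n' \o Psi (n', S n') else id.
(* Each stage is a subsequence of all earlier ones, so the diagonal is eventually a subsequence of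
   each stage. *)
have tail i n : exists2 T : nat -> nat, {homo T : m n / (m < n)%N} &
    S (i + n)%N = S i \o T.
  elim: n => [|n [T homoT ST]]; first by exists id; rewrite ?addn0.
  exists (T \o Psi ((i + n)%N, S (i + n)%N)).
    by move=> a b ab; apply/homoT/(PsiP _).1.
  by rewrite addnS /= ST.
have homoS n : {homo S n : a b / (a < b)%N}.
  by have [T homoT] := tail 0%N n; rewrite add0n => ->.
exists (fun k => S k k) => [|i].
  apply: homo_ltn => [|k]; first exact: ltn_trans.
  by rewrite /= homoS// (@leq_trans k.+1)// homo_ltn_ge//; exact: (PsiP _).1.
have [_ [l lP]] := PsiP (i, S i); exists l => e /lP[N NP].
exists (maxn N i.+1) => k; rewrite geq_max => /andP[Nk ik].
have [T homoT ST] := tail i.+1 (k - i.+1)%N.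
rewrite subnKC// in ST; rewrite /= ST; apply: (NP (T k)).
by rewrite (leq_trans Nk)// homo_ltn_ge.
Qed.

Lemma dense_sequence : exists q : nat -> C,
  forall z e, 0 < e -> exists i, cmod (q i - z) < e.
Proof.
pose q n : C := if @unpickle (rat * rat)%type n is Some p
  then cpt (ratr p.1) (ratr p.2) else 0.
exists q => z e e0; have e20 : 0 < e / 2 by rewrite divr_gt0.
have near (x : R) : exists r : rat, `|ratr r - x| < e / 2.
  have [r] := @rat_in_itvoo R (x - e / 2) (x + e / 2) ltac:(lra).
  by rewrite in_itv /= => /andP[r1 r2]; exists r; rewrite ltr_norml; lra.
have [r rP] := near (complex.Re z); have [s sP] := near (complex.Im z).
exists (pickle (r, s)); rewrite /q pickleK.
apply: le_lt_trans (cmod_le_ReIm _) _.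
by case: z rP sP => x y /= rP sP; rewrite [ltRHS]splitr ltrD.
Qed.

(* Pointwise convergence on a dense sequence upgrades, by the common Lipschitz
   constant, to uniform convergence. *)
Lemma equilipschitz_subsequence (D : set C) (g : nat -> C -> C) B L Lambda :
  open D -> 0 <= Lambda ->
  (forall z, D z -> cmod z <= B) ->
  (forall k z, D z -> cmod (g k z) <= L) ->
  (forall k z w, D z -> D w -> cmod (g k z - g k w) <= Lambda * cmod (z - w)) ->
  exists2 phi : nat -> nat, {homo phi : m n / (m < n)%N} &
    exists h : C -> C, {uniform D, g \o phi @ \oo --> h}.
Proof.
move=> oD La0 DB gL gLip; have [q qdense] := dense_sequence.
pose u i k : C := if `[< D (q i) >] then g k (q i) else 0.
have uB i k : cmod (u i k) <= `|L|.
  rewrite /u; case: asboolP => [Dq|_]; last by rewrite cmod0.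
  by rewrite (le_trans (gL k _ Dq))// ler_norm.
have [phi homo_phi phiP] := diagonal_extraction uB.
exists phi => //.
(* Only a cluster value is chosen at each point; the argument below turns it into a uniform
   limit. *)
have exh z : exists l : C, D z -> forall e, 0 < e -> forall N, exists2 k, (N <= k)%N &
    cmod (g (phi k) z - l) < e.
  have [Dz|] := pselect (D z); last by exists 0.
  have [psi homo_psi [l lP]] := @bolzano_weierstrass_cplx R (fun k => g (phi k) z) L
    (fun k => gL _ _ Dz).
  exists l => _ e /lP[K KP] N; exists (psi (maxn K N)).
    by rewrite (leq_trans (leq_maxr K N))// homo_ltn_ge.
  by apply: KP; exact: leq_maxl.
have [h hP] := choice exh; exists h; apply/uniform_cmodP => e e0.
apply: contrapT => noN.
have bad K : exists p : nat * nat * C, [/\ (K <= p.1.1)%N, (K <= p.1.2)%N, D p.2 &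
    e / 2 <= cmod (g (phi p.1.1) p.2 - g (phi p.1.2) p.2)].
  apply: contrapT => nobad; apply: noN; exists K => k Kk w Dw.
  rewrite ltNge; apply/negP => far.
  have [j Kj jP] := hP w Dw (e / 2) (divr_gt0 e0 (ltr0n _ 2)) K.
  apply: nobad; exists (k, j, w); split => //=.
  have := cmod_dist (h w) (g (phi k) w) (g (phi j) w).
  rewrite /= in far; rewrite cmodB in jP; rewrite (cmodB (g (phi j) w)).
  by move: far jP; lra.
have [p pP] := choice bad.
have [psi homo_psi [wl wlP]] := @bolzano_weierstrass_cplx R (fun K => (p K).2) B
  (fun K => let: And4 _ _ Dp _ := pP K in DB _ Dp).
(* Moving by 3 eta changes each function by at most e/8. Two such moves and two errors e/16 at the
   dense point total 3e/8, below the gap e/2. *)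
pose eta := e / (24 * (Lambda + 1)).
have eta0 : 0 < eta by rewrite divr_gt0// mulr_gt0// ltr_wpDl.
have La_eta : Lambda * (3 * eta) <= e / 8.
  rewrite /eta mulrA mulrCA mulrA ler_pdivrMr ?mulr_gt0 ?ltr_wpDl//.
  rewrite -subr_ge0 (_ : _ - _ = 3 * e); last by field.
  by rewrite mulr_ge0// ltW.
have [N NP] := wlP _ eta0.
(* The limit [wl] may lie outside D, so the dense point is chosen near a term of the sequence, which
   lies in D. *)
have [_ _ Dw0 _] := pP (psi N); set w0 := (p (psi N)).2 in Dw0.
have /open_cmodP/(_ _ Dw0)[d d0 dP] := oD.
have m0 : 0 < Num.min d eta by rewrite lt_min d0.
have [i qi] := qdense w0 _ m0; move: qi; rewrite lt_min => /andP[qd qeta].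
have Dq : D (q i) by exact: dP.
have [l lP] := phiP i; have e160 : 0 < e / 16 by rewrite divr_gt0.
have [N2 N2P] := lP _ e160.
have uE k : u i k = g k (q i) by rewrite /u asboolT.
pose K := maxn N N2; have NK : (N <= K)%N by exact: leq_maxl.
have N2K : (N2 <= psi K)%N by rewrite (leq_trans (leq_maxr N N2))// homo_ltn_ge.
have [K1 K2 Dw far] := pP (psi K); set k1 := (p (psi K)).1.1 in K1 far.
set k2 := (p (psi K)).1.2 in K2 far; set w := (p (psi K)).2 in Dw far.
have wq : cmod (w - q i) <= 3 * eta.
  have := NP K NK; have := NP N (leqnn _); rewrite -/w -/w0.
  have := cmod_dist w (q i) wl; have := cmod_dist wl (q i) w0.
  by rewrite (cmodB wl w0) (cmodB w0 (q i)); lra.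
have gclose k : cmod (g k w - g k (q i)) <= e / 8.
  by apply: le_trans (gLip _ _ _ Dw Dq) _; apply: le_trans La_eta; rewrite ler_wpM2l.
have := N2P k1 (leq_trans N2K K1); have := N2P k2 (leq_trans N2K K2).
rewrite /= !uE.
have := gclose (phi k1); have := gclose (phi k2).
have := cmod_dist (g (phi k1) w) (g (phi k2) w) (g (phi k1) (q i)).
have := cmod_dist (g (phi k1) (q i)) (g (phi k2) w) l.
have := cmod_dist l (g (phi k2) w) (g (phi k2) (q i)).
rewrite (cmodB l (g (phi k2) (q i))) (cmodB (g (phi k2) (q i)) (g (phi k2) w)).
lra.
Qed.

(** Points of the quarter disc are less than rho/2 apart, and the closed discs of radius rho/2 about
    them stay in the large disc; this yields one Lipschitz constant for the family. *)
Lemma montel_disc (F : set (C -> C)) c rho L : 0 < rho ->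
  (forall g, F g -> forall z, disc c rho z -> derivable g z 1 /\ cmod (g z) <= L) ->
  normal_family (disc c (rho / 4)) F.
Proof.
move=> rho0 FL g Fg.
have r4 : 0 < rho / 4 by rewrite divr_gt0.
have sub z : disc c (rho / 4) z -> disc c rho z.
  by rewrite /disc /=; move: rho0; lra.
have L0 : 0 <= L.
  rewrite (le_trans (cmod_ge0 (g 0%N c)))//; apply: (FL _ (Fg 0%N) _ _).2.
  by rewrite /disc /= subrr cmod0.
have [|||||phi homo_phi [h hP]] := @equilipschitz_subsequence (disc c (rho / 4)) g
  (rho / 4 + cmod c) L (2 * L / (rho / 2)).
- exact: disc_open.
- by apply: divr_ge0; [exact: mulr_ge0|rewrite divr_ge0// ltW].
- by move=> z /ltW; exact: disc_bounded.
- by move=> k z /sub dz; exact: (FL _ (Fg k) _ dz).2.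
- move=> k z w dz dw.
  have inD t : cmod (t - w) <= rho / 2 -> disc c rho t.
    move=> tw; have := cmod_dist t c w; rewrite /disc /= in dw *; lra.
  apply: schwarz_lipschitz.
  + by rewrite divr_gt0.
  + by move=> t /inD dt; exact: (FL _ (Fg k) _ dt).1.
  + by move=> t /inD dt; exact: (FL _ (Fg k) _ dt).2.
  + have := cmod_dist z w c; rewrite (cmodB c); rewrite /disc /= in dz dw; lra.
exists phi => //; left; exists h => z dz; exists (disc c (rho / 4)) => //.
by apply: open_nbhs_nbhs; split => //; exact: disc_open.
Qed.

End Montel.

(** * Fatou components and their orbits *)

Section Fatou.
Context {R : realType}.
Local Notation C := (Cplx R).
Implicit Types (z w c : C) (e rho M B L : R) (f g h : C -> C).

Lemma entire_iter f n : entire f -> entire (iter n f).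
Proof.
move=> fE; elim: n => [|n IH] z; first exact: derivable1_id.
exact: (@derivable1_comp _ (iter n f) f z (IH z) (fE _)).
Qed.

Lemma entire_continuous f : entire f -> continuous f.
Proof. by move=> fE z; exact: derivable1_cts. Qed.

Lemma disc_center c rho : 0 < rho -> disc c rho c.
Proof. by rewrite /disc /= subrr cmod0. Qed.

Lemma disc_connected c rho : connected (disc c rho).
Proof.
have [rho0|rho0] := ltP 0 rho; last first.
  rewrite (_ : disc c rho = set0); first exact: connected0.
  rewrite -subset0 => z zc; have := cmod_ge0 (z - c).
  by rewrite leNgt (lt_le_trans zc rho0).
pose seg z (t : R) : C := c + t%:C%C * (z - c).
have segB z t : cmod (seg z t - c) = `|t| * cmod (z - c).
  by rewrite /seg addrC addKr cmodM cmodR.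
rewrite (_ : disc c rho = \bigcup_(z in disc c rho) (seg z @` `[0, 1])); last first.
  apply/seteqP; split => [z zc|z [w wc [t]]].
    exists z => //; exists 1; first by rewrite /= in_itv /= ler01 lexx.
    by rewrite /seg rmorph1 mul1r addrC subrK.
  rewrite /= in_itv /= => /andP[t0 t1] <-; rewrite /disc /= segB ger0_norm//.
  by apply: le_lt_trans wc; rewrite ler_piMl// cmod_ge0.
apply: bigcup_connected => [|z zc].
  exists c => z _; exists 0; first by rewrite /= in_itv /= lexx ler01.
  by rewrite /seg rmorph0 mul0r addr0.
apply: connected_continuous_connected; first exact: segment_connected.
apply: continuous_subspaceT => t V /nbhs_cmodP[d d0 dV].
have z1 : 0 < cmod (z - c) + 1 by rewrite ltr_wpDl// cmod_ge0.
apply/nbhs_ballP; exists (d / (cmod (z - c) + 1)); first by rewrite /= divr_gt0.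
move=> s; rewrite -ball_normE /= => ts; apply: dV.
have -> : seg z s - seg z t = (s - t)%:C%C * (z - c).
  by rewrite /seg rmorphB; ring.
rewrite ltr_pdivlMr// in ts; rewrite cmodM cmodR distrC (le_lt_trans _ ts)//.
by rewrite ler_wpM2l// lerDl.
Qed.

Lemma fatou_open f : open (fatou_set f).
Proof.
rewrite openE => z [D [oD Dz nD]]; rewrite /interior.
apply: (filterS _ (open_nbhs_nbhs (conj oD Dz))) => w Dw; by exists D.
Qed.

Lemma fatou_of_bounded f c rho L : entire f ->
  (forall n z, (0 < n)%N -> disc c rho z -> cmod (iter n f z) <= L) ->
  disc c rho `<=` fatou_set f.
Proof.
move=> fE fL z zc; have d0 : 0 < rho - cmod (z - c) by rewrite subr_gt0.
exists (disc z ((rho - cmod (z - c)) / 4)); split.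
- exact: disc_open.
- by apply: disc_center; rewrite divr_gt0.
apply: montel_disc d0 _ => _ [n n0 <-] w wz; split; first exact: entire_iter.
apply: fL => //; rewrite /disc /= in wz *.
by apply: le_lt_trans (cmod_dist _ _ z) _; rewrite -ltrBrDr.
Qed.

Lemma iterates_index f (g : nat -> C -> C) : (forall k, iterates f (g k)) ->
  exists N : nat -> nat, forall k, (0 < N k)%N /\ g k = iter (N k) f.
Proof.
move=> gf.
have ex k : exists n, (0 < n)%N /\ g k = iter n f.
  by have [n n0 <-] := gf k; exists n.
by have [N NP] := choice ex; exists N.
Qed.

(** Normality on D is applied to the iterates of index N k - 1. Since [iterates] starts at index 1,
    N k must exceed 1. *)
Lemma normal_family_comp f (D : set C) (N : nat -> nat) :
  entire f -> normal_family D (iterates f) -> (forall k, (1 < N k)%N) ->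
  exists2 phi : nat -> nat, {homo phi : m n / (m < n)%N} &
    (exists h, cvg_locally_uniformly (f @^-1` D) ((fun k => iter (N k) f) \o phi) h) \/
    cvg_locally_uniformly_infty (f @^-1` D) ((fun k => iter (N k) f) \o phi).
Proof.
move=> fE nD N1; pose g k := iter (N k).-1 f.
have gf k : iterates f (g k) by exists (N k).-1 => //=; rewrite -ltnS prednK// ltnW.
have gE k z : iter (N k) f z = g k (f z).
  by rewrite /g -iterSr prednK// ltnW.
have [phi homo_phi lim] := nD g gf; exists phi => //.
case: lim => [[h hP]|gP]; [left; exists (h \o f)|right] => z Dz.
  have [V Vz /uniform_cmodP VP] := hP _ Dz; exists (f @^-1` V).
    exact: entire_continuous.
  apply/uniform_cmodP => e /VP[K KP]; exists K => k Kk w Vw.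
  by rewrite /= gE; exact: (KP k Kk _ Vw).
have [V Vz VP] := gP _ Dz; exists (f @^-1` V).
  exact: entire_continuous.
move=> M; have [K _ KP] := VP M; exists K => // k Kk w Vw.
by rewrite /= gE; exact: (KP k Kk _ Vw).
Qed.

Lemma fatou_backward f z : entire f -> fatou_set f (f z) -> fatou_set f z.
Proof.
move=> fE [D [oD Dz nD]]; exists (f @^-1` D); split => //.
  by apply: open_comp => // w _; exact: entire_continuous.
move=> g /iterates_index[N NP].
have gE : g = fun k => iter (N k) f by apply/funext => k; have [_ ->] := NP k.
have [[K KP]|noK] := pselect (exists K, forall k, (K <= k)%N -> (1 < N k)%N).
  have [phi homo_phi lim] := @normal_family_comp f D (fun k => N (k + K)%N) fE nD
    (fun k => KP _ (leq_addl _ _)).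
  exists (fun k => (phi k + K)%N); first by move=> a b ab; rewrite ltn_add2r homo_phi.
  by rewrite gE.
(* The remaining case: index 1 recurs forever, and the constant subsequence f converges. *)
have nx K : exists k, (K <= k)%N /\ N k = 1%N.
  apply: contrapT => nok; apply: noK; exists K => k Kk; have [N0 _] := NP k.
  by rewrite ltn_neqAle N0 andbT; apply/eqP => N1; apply: nok; exists k.
have [nxt nxtP] := choice nx.
pose phi := fix phi n := if n is n'.+1 then nxt (phi n').+1 else nxt 0%N.
exists phi.
  by apply: homo_ltn => [|n]; [exact: ltn_trans|have [] := nxtP (phi n).+1].
have phi1 k : N (phi k) = 1%N by case: k => [|k] /=; exact: (nxtP _).2.
left; exists f => w Dw; exists setT; first exact: filterT.
apply/uniform_cmodP => e e0; exists 0%N => k _ v _.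
by rewrite /= gE phi1 /= subrr cmod0.
Qed.

Lemma converges_unique (u : nat -> C) l l' : converges u l -> converges u l' -> l = l'.
Proof.
move=> ul ul'; apply/eqP; rewrite -subr_eq0 -cmod_eq0 eq_le cmod_ge0 andbT.
apply/ler_addgt0Pl => e e0; rewrite addr0.
have [N NP] := ul _ (divr_gt0 e0 (ltr0n _ 2)).
have [N' NP'] := ul' _ (divr_gt0 e0 (ltr0n _ 2)).
have := NP _ (leq_maxl N N'); have := NP' _ (leq_maxr N N').
have := cmod_dist l l' (u (maxn N N')); rewrite (cmodB l (u _)); lra.
Qed.

(** A nonconstant f is open, so images of neighbourhoods are neighbourhoods and normality at z can
    be pushed to f z. *)
Lemma fatou_forward f z : entire f -> (forall w, exists v, f v != f w) ->
  fatou_set f z -> fatou_set f (f z).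
Proof.
move=> fE fnc [D [oD Dz nD]].
have open_image w (V : set C) : nbhs w V -> exists2 d, 0 < d &
    forall v, cmod (v - f w) < d -> exists2 x, V x & f x = v.
  move=> /nbhs_cmodP[e e0 eV]; have [v vw] := fnc w.
  have [d d0 dP] := open_mapping fE vw e0; exists d => // x /dP[y ye <-].
  by exists y => //; exact: eV.
have [d d0 dP] := open_image z D (open_nbhs_nbhs (conj oD Dz)).
exists (disc (f z) d); split; [exact: disc_open|exact: disc_center|].
move=> g /iterates_index[N NP].
pose g' k := iter (N k).+1 f.
have g'f k : iterates f (g' k) by exists (N k).+1.
have gE k w : g k (f w) = g' k w by rewrite /g' iterSr; have [_ ->] := NP k.
have [phi homo_phi lim] := nD g' g'f; exists phi => //.
case: lim => [[h hP]|gP]; [left|right]; last first.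
  move=> _ /dP[w Dw <-]; have [V Vw VP] := gP _ Dw; exists (f @` V).
    by apply/nbhs_cmodP; have [d' d'0 d'P] := open_image w V Vw; exists d'.
  move=> M; have [K _ KP] := VP M; exists K => // k Kk _ [x Vx <-].
  by rewrite /= gE; exact: (KP k Kk).
(* As f need not be injective, h does not visibly factor through f. The limit on the image is taken
   pointwise from the sequence itself, with 0 where it diverges, and then identified with [h x] at
   [f x]. *)
have exH w : exists l, forall l', converges (fun k => g (phi k) w) l' -> l = l'.
  have [[l ul]|nol] := pselect (exists l, converges (fun k => g (phi k) w) l).
    by exists l => l'; exact: converges_unique.
  by exists 0 => l' ul'; case: nol; exists l'.
have [H HP] := choice exH; exists H => _ /dP[w Dw <-].
have [V Vw /uniform_cmodP VP] := hP _ Dw; exists (f @` V).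
  by apply/nbhs_cmodP; have [d' d'0 d'P] := open_image w V Vw; exists d'.
apply/uniform_cmodP => e /VP[K KP]; exists K => k Kk _ [x Vx <-].
rewrite (HP (f x) (h x)); first by rewrite /= gE; exact: KP.
move=> e' /VP[K' KP']; exists K' => j /KP'/(_ x Vx).
by rewrite gE cmodB.
Qed.

End Fatou.

(** * The orbit of the wandering domain and its annuli *)

Section Wandering_orbit.
Context {R : realType}.
Local Notation C := (Cplx R).
Implicit Types (z w c : C) (e rho M B L : R).
Context (f : C -> C) (U : set C) (z0 : C).
Context (fE : entire f) (f_nc : forall w, exists v, f v != f w).
Context (U_wd : wandering_domain f U) (U_z0 : U z0).

Local Notation F := (fatou_set f).
Local Notation V n := (fatou_orbit f U n).
Local Notation Z n := (iter n f z0).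

Lemma iter_fatou n z : F z -> F (iter n f z).
Proof. by move=> Fz; elim: n => //= n; exact: fatou_forward. Qed.

Lemma iter_not_fatou n z : ~ F z -> ~ F (iter n f z).
Proof. by move=> Fz; elim: n => //= n IH /fatou_backward -/(_ fE). Qed.

Lemma iter_component n z w : connected_component F z w ->
  connected_component F (iter n f z) (iter n f w).
Proof.
move=> [A [Az AF Ac] Aw]; exists (iter n f @` A); last by exists w.
split; [by exists z| |].
  by move=> _ [x Ax <-]; apply/iter_fatou/AF.
apply: connected_continuous_connected Ac _.
by apply: continuous_subspaceT; exact/entire_continuous/entire_iter.
Qed.

Lemma component_disc c rho z w : disc c rho `<=` F -> disc c rho z ->
  disc c rho w -> connected_component F z w.
Proof.
move=> dF dz dw; exists (disc c rho) => //; split => //; exact: disc_connected.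
Qed.

Lemma fatou_orbitE n : V n = connected_component F (Z n).
Proof.
have [[zc Fzc UE] _] := U_wd.
have Uc w : U w -> connected_component F z0 w.
  move: U_z0; rewrite UE => /same_connected_component -> //.
apply/seteqP; split => [z [_ [w Uw <-]] wz|z Zz].
  exact: connected_component_trans (iter_component n (Uc w Uw)) wz.
by exists (Z n) => //; exists z0.
Qed.

Lemma orbit_sub n : V n `<=` F.
Proof. by rewrite fatou_orbitE; exact: connected_component_sub. Qed.

Lemma orbit_mem n : V n (Z n).
Proof.
rewrite fatou_orbitE; apply/connected_component_refl/iter_fatou.
by have [[zc _ UE] _] := U_wd; move: U_z0; rewrite UE => /connected_component_sub.
Qed.

Lemma orbit_open n : open (V n).
Proof.
apply/open_cmodP => z; rewrite fatou_orbitE => Vz.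
have Fz := connected_component_sub Vz.
have [d d0 dF] := (@open_cmodP R F).1 (@fatou_open R f) z Fz; exists d => // w wz.
apply: connected_component_trans Vz _.
by apply: (component_disc (c := z) (rho := d)) => //; exact: disc_center.
Qed.

Lemma orbit_connected n : connected (V n).
Proof. by rewrite fatou_orbitE; exact: component_connected. Qed.

Lemma orbit_map n j z : V n z -> V (n + j) (iter j f z).
Proof.
rewrite !fatou_orbitE => /(iter_component j).
by rewrite -iterD addnC.
Qed.

Lemma orbit_boundary n z : closure (V n) z -> ~ V n z -> ~ F z.
Proof.
rewrite fatou_orbitE => Vz nVz Fz; apply: nVz.
have [d d0 dF] := (@open_cmodP R F).1 (@fatou_open R f) z Fz.
have /closure_cmodP/(_ _ d0)[w Vw wz] := Vz.
apply: connected_component_trans Vw _.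
by apply: (component_disc (c := z) (rho := d)) => //; exact: disc_center.
Qed.

(** A coincidence at n < k propagates forward and makes the orbit periodic with period k - n from n
    on. *)
Lemma same_component_index n k : connected_component F (Z n) (Z k) -> n = k.
Proof.
wlog nk : n k / (n < k)%N => [H nkF|].
  have [/H|/H|//] := ltngtP n k; first by apply.
  by move=> /(_ (connected_component_sym nkF)) ->.
move=> nkF; have [_ []] := U_wd; exists n, (k - n)%N; split; first by rewrite subn_gt0.
move=> m nm; rewrite !fatou_orbitE; apply/esym/same_connected_component.
have := iter_component (m - n) nkF; rewrite -!iterD subnK//.
by rewrite (_ : m - n + k = m + (k - n))%N//; lia.
Qed.

Lemma orbit_disjoint n k z : V n z -> V k z -> n = k.
Proof.
rewrite !fatou_orbitE => nz kz; apply: same_component_index.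
exact: connected_component_trans nz (connected_component_sym kz).
Qed.

Lemma orbit_disc c rho n k : disc c rho `<=` F -> disc c rho (Z n) ->
  disc c rho (Z k) -> n = k.
Proof. by move=> dF dn dk; apply/same_component_index/(component_disc dF). Qed.

Lemma max_principle_circle (g : C -> C) rho M : entire g ->
  (forall z, cmod z = rho -> cmod (g z) <= M) ->
  forall z, cmod z <= rho -> cmod (g z) <= M.
Proof.
move=> gE gM z zr; have [/eqP zr'|zr'] := boolP (cmod z == rho); first exact: gM.
have dE w : disc 0 rho w = (cmod w < rho) :> Prop by rewrite /disc /= subr0.
apply: (@max_principle R (disc 0 rho) g (rho + cmod (0 : C))).
- exact: disc_open.
- by move=> w /ltW; exact: disc_bounded.
- by move=> w _; exact: gE.
- move=> w /closure_disc; rewrite dE subr0 => wr /negP; rewrite -leNgt => wr'.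
  by apply: gM; apply/eqP; rewrite eq_le wr.
- by rewrite dE lt_neqAle zr'.
Qed.

Lemma connected_avoids_circle (A : set C) rho : connected A ->
  (forall z, A z -> cmod z != rho) ->
  (forall z, A z -> cmod z < rho) \/ (forall z, A z -> rho < cmod z).
Proof.
move=> cA Ar; have [[z Az zr]|no] := pselect (exists2 z, A z & cmod z < rho).
  left=> w Aw; have dE v : disc 0 rho v = (cmod v < rho) :> Prop.
    by rewrite /disc /= subr0.
  have <- : disc 0 rho w = (cmod w < rho) :> Prop by exact: dE.
  have : (A `&` disc 0 rho) w; last by case.
  rewrite (cA (A `&` disc 0 rho))//.
  - by exists z; split => //; rewrite dE.
  - by exists (disc 0 rho) => //; exact: disc_open.
  - exists [set v : C | cmod (v - 0) <= rho]; first exact: closed_cdisc.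
    apply/seteqP; split => v [Av]; first by rewrite /disc /= => /ltW.
    by rewrite /= subr0 => vr; split => //; rewrite dE lt_neqAle Ar.
right=> w Aw; rewrite ltNge le_eqVlt negb_or Ar//=.
by apply/negP => wr; apply: no; exists w.
Qed.

Context (s t : nat -> R) (N0 : nat).
Context (st : forall n, (N0 <= n)%N -> [/\ 0 < s n, annulus (s n) (t n) `<=` V n
  & s n < cmod (Z n) < t n]).

Local Notation r n := (cmod (Z n)).

(** [V k] is disjoint from [V n], hence misses its annulus; being connected, it stays on one side of
    the circle of radius [r n]. *)
Lemma orbit_inside_or_outside n k : (N0 <= n)%N -> k <> n ->
  (forall z, V k z -> cmod z <= s n) \/ (forall z, V k z -> t n <= cmod z).
Proof.
move=> N0n kn; have [s0 sV /andP[sr rt]] := st N0n.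
have Va z : V k z -> ~~ (s n < cmod z < t n).
  by move=> Vz; apply/negP => /sV Vnz; apply: kn; exact: orbit_disjoint Vz Vnz.
have [|H|H] := @connected_avoids_circle (V k) (r n) (@orbit_connected k).
- by move=> z /Va; apply: contraNneq => ->; rewrite sr rt.
- left=> z Vz; have := Va z Vz; rewrite negb_and -!leNgt => /orP[//|tz].
  by have := le_lt_trans tz (H z Vz); rewrite ltNge (ltW rt).
- right=> z Vz; have := Va z Vz; rewrite negb_and -!leNgt => /orP[sz|//].
  by have := lt_le_trans (H z Vz) sz; rewrite ltNge (ltW sr).
Qed.

(** If [V n.+1] lay inside, f would send a circle of radius rho > [r n] in the annulus into |z| <=
    [s n], hence the disc of radius rho into itself. That disc would then be in the Fatou set and
    contain both [Z n] and [Z n.+1]. *)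
Lemma orbit_next_outside n : (N0 <= n)%N -> forall z, V n.+1 z -> t n <= cmod z.
Proof.
move=> N0n; have [s0 sV /andP[sr rt]] := st N0n.
have [inn|//] := orbit_inside_or_outside N0n (@n_Sn n \o esym).
exfalso; pose rho := (r n + t n) / 2.
have rrho : r n < rho by rewrite /rho; lra.
have rhot : rho < t n by rewrite /rho; lra.
clearbody rho.
have fs z : cmod z <= rho -> cmod (f z) <= s n.
  apply: max_principle_circle => // w wr; apply: inn; rewrite -[n.+1]addn1.
  apply: (@orbit_map n 1); apply: sV; rewrite /annulus /= wr rhot andbT.
  exact: lt_trans rrho.
have iters k z : (0 < k)%N -> disc 0 rho z -> cmod (iter k f z) <= s n.
  case: k => // k _; rewrite /disc /= subr0 => zr.
  elim: k => [|k IH]; first exact/fs/ltW.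
  apply: fs; apply: le_trans IH _; exact: le_trans (ltW sr) (ltW rrho).
have := fatou_of_bounded fE iters => dF.
have dn : disc 0 rho (Z n) by rewrite /disc /= subr0.
have dn1 : disc 0 rho (Z n.+1).
  rewrite /disc /mkset subr0; apply: le_lt_trans (fs _ (ltW rrho)) _.
  exact: lt_trans rrho.
by have /n_Sn := orbit_disc dF dn dn1.
Qed.

Lemma r_step n : (N0 <= n)%N -> r n < r n.+1.
Proof.
move=> N0n; have [_ _ /andP[_ rt]] := st N0n.
exact: lt_le_trans rt (orbit_next_outside N0n (orbit_mem _)).
Qed.

Lemma r_mono n k : (N0 <= n)%N -> (n < k)%N -> r n < r k.
Proof.
move=> N0n; elim: k => // k IH; rewrite ltnS leq_eqVlt => /orP[/eqP <-|nk].
  exact: r_step.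
by apply: lt_trans (IH nk) (r_step _); rewrite (leq_trans N0n)// ltnW.
Qed.

Lemma orbit_outside n k : (N0 <= n)%N -> (n < k)%N -> forall z, V k z -> t n <= cmod z.
Proof.
move=> N0n nk; have [_ _ /andP[sr _]] := st N0n.
have [|inn|//] := @orbit_inside_or_outside n k N0n.
  by move=> kn; rewrite kn ltnn in nk.
have := inn _ (orbit_mem k); have := r_mono N0n nk.
by move=> rk /(lt_le_trans rk) /(lt_trans sr); rewrite ltxx.
Qed.

Lemma orbit_inside n k : (N0 <= n)%N -> (n < k)%N -> forall z, V n z -> cmod z <= s k.
Proof.
move=> N0n nk; have N0k := leq_trans N0n (ltnW nk).
have [_ _ /andP[_ rt]] := st N0k.
have [|//|out] := @orbit_inside_or_outside k n N0k.
  by move=> kn; rewrite kn ltnn in nk.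
have := out _ (orbit_mem n); have := r_mono N0n nk.
by move=> rk /(lt_le_trans rt) /(lt_trans rk); rewrite ltxx.
Qed.

(** If all r n were at most L, the nesting would bound every iterate by L on a circle in the annulus
    of [V m], hence on its disc, which would lie in the Fatou set. *)
Lemma r_unbounded L : exists2 N, (N0 <= N)%N & forall n, (N <= n)%N -> L < r n.
Proof.
apply: contrapT => bnd.
have rL n : (N0 <= n)%N -> r n <= L.
  move=> N0n; rewrite leNgt; apply/negP => Lr; apply: bnd; exists n => // k.
  by rewrite leq_eqVlt => /orP[/eqP <-//|/(r_mono N0n)]; exact: lt_trans.
(* One step past N0, so that the disc holds the two orbit points [Z N0] and [Z m]. *)
pose m := N0.+1; have N0m : (N0 <= m)%N by exact: leqnSn.
have [s0 sV /andP[sr rt]] := st N0m.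
pose rho := (r m + t m) / 2.
have rrho : r m < rho by rewrite /rho; lra.
have rhot : rho < t m by rewrite /rho; lra.
clearbody rho.
have iters k z : (0 < k)%N -> disc 0 rho z -> cmod (iter k f z) <= L.
  rewrite /disc /mkset subr0 => _ zr; apply: max_principle_circle (ltW zr).
    exact: entire_iter.
  move=> w wr; have Vw : V m w.
    by apply: sV; rewrite /annulus /= wr rhot andbT; exact: lt_trans rrho.
  have N0mk : (N0 <= m + k)%N by rewrite (leq_trans N0m)// leq_addr.
  apply: le_trans (orbit_inside N0mk (ltnSn _) (orbit_map k Vw)) _.
  have N0mk1 : (N0 <= (m + k).+1)%N by exact: leqW.
  have [_ _ /andP[sr' _]] := st N0mk1.
  exact: le_trans (ltW sr') (rL _ N0mk1).
have dF := fatou_of_bounded fE iters.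
have dm : disc 0 rho (Z m) by rewrite /disc /mkset subr0.
have dN : disc 0 rho (Z N0).
  by rewrite /disc /mkset subr0; exact: lt_trans (r_step (leqnn _)) rrho.
by have /n_Sn := orbit_disc dF dN dm.
Qed.

End Wandering_orbit.

(** * Separation of the boundary of a domain *)

Section Boundary_splitting.
Context {R : realType}.
Local Notation C := (Cplx R).
Implicit Types (z w p : C) (e h B : R).

Definition rnd (x : R) : int := Num.floor (x + 2^-1).

Lemma rndE (x : R) (m : int) : `|x - m%:~R| < 2^-1 -> rnd x = m.
Proof.
rewrite ltr_norml => /andP[x1 x2]; apply: floor_def; rewrite intrD.
by apply/andP; split; lra.
Qed.

Lemma connected_locally_constant (T : Type) (A : set C) (N : C -> T) h : 0 < h ->
  connected A -> (forall z w, A z -> A w -> cmod (z - w) < h -> N z = N w) ->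
  forall z w, A z -> A w -> N z = N w.
Proof.
move=> h0 cA locN z w Az Aw.
pose E (P : set C) := \bigcup_(v in A `&` P) disc v h.
have oE P : open (E P) by apply: bigcup_open => v _; exact: disc_open.
have AE (P : set C) : (forall u v, A u -> A v -> cmod (u - v) < h -> P v -> P u) ->
    A `&` P = A `&` E P.
  move=> homP; apply/seteqP; split => u [Au].
    by move=> Pu; split => //; exists u; [split|exact: disc_center].
  by move=> [v [Av Pv] uv]; split => //; exact: homP uv Pv.
have : (A `&` [set v | N v = N z]) w; last by case.
rewrite (cA (A `&` [set v | N v = N z]))//.
- by exists z.
- exists (E [set v | N v = N z]) => //; apply: AE => u v Au Av uv /= <-.
  exact: locN.
exists (~` E [set v | N v <> N z]); first exact: open_closedC.
have H : A `&` [set v | N v <> N z] = A `&` E [set v | N v <> N z].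
  apply: AE => u v Au Av uv /= vz uz; apply: vz; rewrite -uz; apply: locN => //.
  by rewrite cmodB.
apply/seteqP; split => u [Au Nu]; split => //.
  move=> Eu; have : (A `&` E [set v | N v <> N z]) u by split.
  by rewrite -H => -[].
apply: contrapT => nu; apply: Nu.
have : (A `&` [set v | N v <> N z]) u by split.
by rewrite H => -[].
Qed.

(** The disc about z is connected and meets both V and its complement. *)
Lemma boundary_near (V : set C) z w h : open V -> V z -> ~ V w -> cmod (w - z) < h ->
  exists p, [/\ closure V p, ~ V p & cmod (p - z) < h].
Proof.
move=> oV Vz nVw wz; apply: contrapT => nop.
have h0 : 0 < h by exact: le_lt_trans (cmod_ge0 _) wz.
apply: nVw; have : (disc z h `&` V) w; last by case.
rewrite (@disc_connected R z h (disc z h `&` V)) //.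
- by exists z; split => //; exact: disc_center.
- by exists V.
exists (closure V); first exact: closed_closure.
apply/seteqP; split => p [pz Vp]; split => //; first exact: subset_closure.
by apply: contrapT => nVp; apply: nop; exists p.
Qed.

Context (V : set C) (lam : C -> R) (B h : R).
Context (V_open : open V) (V_conn : connected V).
Context (B_gt0 : 0 < B) (V_bnd : forall z, V z -> cmod z < B) (h_gt0 : 0 < h).
Context (h_le1 : h <= 1).
Context (lam_unif : forall z w, cmod z <= B -> cmod w <= B -> cmod (z - w) < h ->
  `|lam z - lam w| < 8^-1).
Context (lam_bd : forall p, closure V p -> ~ V p -> lam p = 0 \/ lam p = 1).

(* lam0 is continuous modulo 1 across the boundary of V; level is the integer
   part of its lift to R along upward vertical rays, normalised to be 0 far up.
   Floors of differences replace the exponential covering. *)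
Definition lam0 z : R := if `[< V z >] then lam z else 0.

Definition jump z w : int := rnd (lam0 z - lam0 w).

(** A short step across the boundary passes near a boundary point, where [lam] is 0 or 1, so [lam0]
    changes by nearly an integer. Two errors below 1/6 total less than 1/2, which makes rounding
    additive in [jump_add]. *)
Lemma jump_near z w : cmod (z - w) < h ->
  `|lam0 z - lam0 w - (jump z w)%:~R| < 6^-1.
Proof.
move=> zw; suff [m mP] : exists m : int, `|lam0 z - lam0 w - m%:~R| < 6^-1.
  by rewrite /jump (rndE (m := m))//; apply: lt_trans mP _; lra.
have inB v : V v -> cmod v <= B by move/V_bnd/ltW.
have half (x : R) : `|x| < 8^-1 -> `|x| < 6^-1 by lra.
have cross u v : V u -> ~ V v -> cmod (u - v) < h ->
    exists m : int, `|lam u - m%:~R| < 6^-1.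
  move=> Vu nVv uv; rewrite cmodB in uv.
  have [p [Vp nVp pu]] := boundary_near V_open Vu nVv uv.
  have : `|lam u - lam p| < 8^-1.
    apply: lam_unif; [exact: inB| |by rewrite cmodB].
    exact: cmod_closure_le Vp.
  by case: (lam_bd Vp nVp) => -> /half H; [exists 0|exists 1].
rewrite /lam0; case: asboolP => [Vz|nVz]; case: asboolP => [Vw|nVw].
- by exists 0; rewrite subr0; apply/half/lam_unif => //; exact: inB.
- by rewrite subr0; exact: cross nVw zw.
- have [|m mP] := cross _ _ Vw nVz; first by rewrite cmodB.
  by exists (- m); rewrite sub0r mulrNz -opprD normrN.
- by exists 0; rewrite !subr0 normr0 invr_gt0.
Qed.

Lemma jump_add z w v : cmod (z - w) < h -> cmod (w - v) < h -> cmod (z - v) < h ->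
  jump z v = jump z w + jump w v.
Proof.
move=> /jump_near zw /jump_near wv zv; apply: rndE; rewrite intrD.
have -> : lam0 z - lam0 v - ((jump z w)%:~R + (jump w v)%:~R) =
  (lam0 z - lam0 w - (jump z w)%:~R) + (lam0 w - lam0 v - (jump w v)%:~R) by ring.
by apply: le_lt_trans (ler_normD _ _) _; lra.
Qed.

Lemma jump_out z w : ~ V z -> ~ V w -> jump z w = 0.
Proof.
move=> nVz nVw; apply: rndE; rewrite /lam0 !asboolF// !subr0 normr0.
by rewrite invr_gt0.
Qed.

(** With steps of h/4 even the diagonals of the ladder between two neighbouring rays are shorter
    than h. From any height above -B - 1, [n0] steps lead past height B and so out of V. *)
Let dl := h / 4.
Let up z k : C := z + cpt 0 (k%:R * dl).
Let n0 := Num.bound ((2 * B + 1) / dl).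

Let dl_gt0 : 0 < dl. Proof. by rewrite divr_gt0. Qed.

Let upE z k : complex.Im (up z k) = complex.Im z + k%:R * dl.
Proof. by rewrite /up raddfD. Qed.

Let upRe z k : complex.Re (up z k) = complex.Re z.
Proof. by rewrite /up raddfD /= addr0. Qed.

Let n0P : 2 * B + 1 <= n0%:R * dl.
Proof.
rewrite -ler_pdivrMr//; apply/ltW/archi_boundP/divr_ge0; last exact: ltW.
by apply: addr_ge0 => //; apply: mulr_ge0 => //; exact: ltW.
Qed.

Definition level z : int := \sum_(k < n0) jump (up z k) (up z k.+1).

Let far_out z : B <= `|complex.Re z| \/ B <= `|complex.Im z| -> ~ V z.
Proof.
by case=> [BR|BI] /V_bnd; rewrite ltNge; apply/negP; rewrite negbK;
  [apply: le_trans BR (Re_le_cmod _)|apply: le_trans BI (Im_le_cmod _)].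
Qed.

(** Adding jumps along both triangles of each rung of the ladder turns the difference of the two
    vertical sums into a telescoping sum: the jump at the bottom minus the jump at the top, which is
    0 outside V. *)
Lemma level_jump z w : - B - 1 < complex.Im z -> - B - 1 < complex.Im w ->
  cmod (z - w) < dl -> level z - level w = jump z w.
Proof.
move=> zB wB zw.
have h0 := h_gt0; have d0 := dl_gt0; have B0 := B_gt0.
have dl_h : 2 * dl < h by rewrite /dl; lra.
have upS u k : cmod (up u k - up u k.+1) = dl.
  have -> : up u k - up u k.+1 = cpt 0 (- dl).
    rewrite /up opprD addrACA subrr add0r cptB subrr -natr1; congr cpt; ring.
  by rewrite /cmod /= expr0n /= add0r sqrtr_sqr normrN ger0_norm// ltW.
have upB k : up z k - up w k = z - w by rewrite /up; ring.
have top u : - B - 1 < complex.Im u -> ~ V (up u n0).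
  move=> uB; apply: far_out; right; apply: le_trans (ler_norm _).
  by rewrite upE; move: n0P; lra.
have step k : jump (up z k) (up z k.+1) - jump (up w k) (up w k.+1) =
    jump (up z k) (up w k) - jump (up z k.+1) (up w k.+1).
  have d1 : cmod (up z k - up w k.+1) < h.
    have := cmod_dist (up z k) (up w k.+1) (up w k); rewrite upB upS; lra.
  have e1 : jump (up z k) (up w k.+1) =
      jump (up z k) (up z k.+1) + jump (up z k.+1) (up w k.+1).
    by apply: jump_add => //; rewrite ?upS ?upB; lra.
  have e2 : jump (up z k) (up w k.+1) =
      jump (up z k) (up w k) + jump (up w k) (up w k.+1).
    by apply: jump_add => //; rewrite ?upS ?upB; lra.
  by apply/eqP; rewrite subr_eq addrAC eq_sym subr_eq -e1 e2.
rewrite /level -sumrB (eq_bigr _ (fun (k : 'I_n0) _ => step k)).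
have -> : jump z w = jump (up z 0) (up w 0).
  have up0 u : up u 0 = u by rewrite /up mul0r; exact: addr0.
  by rewrite !up0.
rewrite -(big_mkord xpredT
  (fun k => jump (up z k) (up w k) - jump (up z k.+1) (up w k.+1))).
rewrite -[X in _ = X]subr0 -[X in _ = _ - X](jump_out (top _ zB) (top _ wB)).
apply/eqP; rewrite -eqr_opp opprB -sumrN; apply/eqP.
under eq_bigr do rewrite opprB.
exact: (telescope_sumr (fun k => jump (up z k) (up w k)) (leq0n n0)).
Qed.

Lemma level_far z : B <= `|complex.Re z| \/ B <= complex.Im z -> level z = 0.
Proof.
move=> zB; rewrite /level big1// => k _; apply: jump_out.
  apply: far_out; rewrite upRe upE; case: zB => [?|zB]; first by left.
  right; apply: le_trans (ler_norm _); apply: le_trans zB _.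
  by rewrite lerDl mulr_ge0// ltW.
apply: far_out; rewrite upRe upE; case: zB => [?|zB]; first by left.
right; apply: le_trans (ler_norm _); apply: le_trans zB _.
by rewrite lerDl mulr_ge0// ltW.
Qed.

(** The ray from z may cross V. A horizontal walk outside V keeps the level unchanged and ends where
    the ray misses V. *)
Lemma level_below z : - B - 1 < complex.Im z -> complex.Im z <= - B -> level z = 0.
Proof.
have B0 := B_gt0; move=> z1 z2; pose q j : C := z + cpt (j%:R * (dl / 2)) 0.
have qIm j : complex.Im (q j) = complex.Im z by rewrite /q raddfD /= addr0.
have qout j : ~ V (q j).
  by apply: far_out; right; rewrite qIm -normrN; apply: le_trans (ler_norm _); lra.
have qS j : level (q j.+1) = level (q j).
  apply/eqP; rewrite -subr_eq0 level_jump ?qIm//; first by rewrite jump_out.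
  have -> : q j.+1 - q j = cpt (dl / 2) 0.
    rewrite /q opprD addrACA subrr add0r cptB subrr -natr1; congr cpt; ring.
  rewrite /cmod /= expr0n /= addr0 sqrtr_sqr ger0_norm; last by rewrite divr_ge0// ltW.
  by move: dl_gt0; lra.
have q0 j : level (q j) = level z.
  elim: j => [|j IH]; last by rewrite qS.
  by rewrite /q mul0r; congr level; exact: addr0.
rewrite -(q0 (Num.bound ((B + `|complex.Re z|) / (dl / 2)))).
apply: level_far; left; apply: le_trans (ler_norm _).
rewrite /q raddfD /= -lerBlDl.
apply: le_trans (_ : B + `|complex.Re z| <= _).
  by rewrite lerD2l -normrN ler_norm.
rewrite -ler_pdivrMr ?divr_gt0// ltW// archi_boundP// divr_ge0 ?divr_ge0//.
  by rewrite addr_ge0// ltW.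
exact: ltW.
Qed.

(** K consists of the points off V of nonzero level. The level is locally constant off V and 0 far
    away, which makes K bounded and relatively open. It has a constant value l on V, hence value l -
    m at a boundary point with lam = m; as l and l - 1 are not both 0, K contains one of the two
    boundary parts. *)
Lemma boundary_splitting : exists2 K : set C,
  [/\ forall z, K z -> ~ V z, forall z, K z -> cmod z <= 2 * B &
      exists2 d, 0 < d & forall z w, K z -> ~ V w -> cmod (w - z) < d -> K w] &
  (forall p, closure V p -> ~ V p -> lam p = 0 -> K p) \/
  (forall p, closure V p -> ~ V p -> lam p = 1 -> K p).
Proof.
have B0 := B_gt0.
exists [set z | [/\ ~ V z, - B - 1 < complex.Im z & level z != 0]].
  have KB z : level z != 0 -> - B - 1 < complex.Im z ->
      [/\ `|complex.Re z| < B, complex.Im z < B & - B < complex.Im z].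
    move=> lz z1; split; rewrite ltNge; apply/negP => zB.
    - by rewrite level_far ?eqxx// in lz; left.
    - by rewrite level_far ?eqxx// in lz; right.
    - by rewrite level_below ?eqxx// in lz.
  split => [z []//|z [_ z1 lz]|].
    have [RB IB1 IB2] := KB z lz z1.
    apply: le_trans (cmod_le_ReIm _) _.
    have : `|complex.Im z| <= B by rewrite ler_norml; apply/andP; split; apply: ltW.
    by move: RB; lra.
  have dl1 : dl <= 1 by rewrite /dl; move: h_le1; lra.
  exists dl => // z w [nVz z1 lz] nVw wz.
  have [RB IB1 IB2] := KB z lz z1.
  have w1 : - B - 1 < complex.Im w.
    have := Im_le_cmod (w - z); rewrite raddfB ler_norml => /andP[H _].
    by move: H wz; lra.
  split => //; have := level_jump w1 z1 wz; rewrite jump_out// => /eqP.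
  by rewrite subr_eq0 => /eqP ->.
have [[z1 Vz1]|noV] := pselect (V !=set0); last first.
  left=> p /closure_cmodP/(_ _ ltr01)[w Vw _].
  by exfalso; apply: noV; exists w.
have VB z : cmod z <= B -> - B - 1 < complex.Im z.
  by have := Im_le_cmod z; rewrite ler_norml => /andP[]; lra.
have lV z w : V z -> V w -> level z = level w.
  apply: (@connected_locally_constant _ V level dl) => // {}z {}w Vz Vw zw.
  apply/eqP; rewrite -subr_eq0 level_jump ?VB ?(ltW (V_bnd _))//.
  apply/eqP/rndE; rewrite /lam0 !asboolT// subr0.
  apply: lt_trans (_ : 8^-1 < _); last by lra.
  apply: lam_unif; rewrite ?(ltW (V_bnd _))//.
  by apply: lt_le_trans zw _; rewrite /dl; move: h_gt0; lra.
have lbd p (m : int) : closure V p -> ~ V p -> lam p = m%:~R -> level p = level z1 - m.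
  move=> Vp nVp lp; have pB : cmod p <= B.
    by apply: cmod_closure_le Vp => z /V_bnd/ltW.
  have [w Vw wp] := (@closure_cmodP R V p).1 Vp _ dl_gt0.
  rewrite (lV z1 w)//; apply/eqP; rewrite addrC -subr_eq level_jump//; last first.
  - by rewrite cmodB.
  - exact/VB/ltW/V_bnd.
  - exact: VB.
  apply/eqP/rndE; rewrite /lam0 asboolF// asboolT// sub0r mulrNz opprK -lp addrC.
  apply: lt_trans (_ : 8^-1 < _); last by lra.
  apply: lam_unif => //; first exact/ltW/V_bnd.
  rewrite cmodB; apply: lt_trans wp _; rewrite /dl; move: h_gt0; lra.
have pB p : closure V p -> cmod p <= B.
  by apply: cmod_closure_le => z /V_bnd/ltW.
have [l1|l1] := eqVneq (level z1) 1; [left|right] => p Vp nVp lp; split => //.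
- exact/VB/pB.
- by rewrite (lbd p 0)// l1.
- exact/VB/pB.
- by rewrite (lbd p 1)// subr_eq0.
Qed.

End Boundary_splitting.

(** * Components of a complement in the Riemann sphere *)

Section Sphere_components.
Context {R : realType}.
Local Notation C := (Cplx R).
Local Notation sphere := (one_point_compactification C).
Implicit Types (z w : C) (A G O V K : set C).

Lemma closed_some_compact A : compact A -> closed A ->
  closed (Some @` A : set sphere).
Proof.
move=> coA cA; rewrite -openC openE => -[z|] /= nA; rewrite /interior.
  have nAz : (~` A) z by move=> Az; apply: nA; exists z.
  have : nbhs z (~` A) by apply: open_nbhs_nbhs; split => //; exact: closed_openC.
  move=> /one_point_compactification_some_nbhs; apply: filterS.
  by move=> _ [w nAw <-] [v Av [vw]]; apply: nAw; rewrite -vw.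
exists A => // -[w|].
  by move=> [[v nAv [<-]]|//] [u Au [uv]]; apply: nAv; rewrite -uv.
by move=> _ [].
Qed.

(** Compactness makes A closed in the sphere, and O shows that A is relatively open in the
    complement of G; a component meeting A cannot leave it. *)
Lemma clopen_component G A O (p q : sphere) : compact A -> closed A -> open O ->
  A `<=` O -> (forall z, O z -> ~ G z -> A z) ->
  connected_component (sphere_compl G) p q -> (Some @` A) p -> (Some @` A) q.
Proof.
move=> coA cA oO AO OG [B [Bp BG cB] Bq] Ap.
suff : (B `&` (Some @` A)) q by case.
rewrite (cB (B `&` (Some @` A)))//.
- by exists p.
- exists (Some @` O); first exact: one_point_compactification_open_some.
  apply/seteqP; split => _ [] /[swap] -[z zP <-] Bz; split => //; exists z => //.
    exact: AO.
  by apply: OG => // Gz; apply: (BG _ Bz); exists z.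
- by exists (Some @` A) => //; exact: closed_some_compact.
Qed.

Lemma three_not_card2 (T : Type) (S : set T) (x y z : T) : S x -> S y -> S z ->
  x <> y -> x <> z -> y <> z -> ~ (S #= `I_2)%card.
Proof.
move=> Sx Sy Sz xy xz yz /card_set_bijP[f [f2 finj0 _]].
have finj u v : S u -> S v -> f u = f v -> u = v.
  by move=> Su Sv; apply: finj0; exact: mem_set.
have fxy : f x <> f y by move=> /(finj _ _ Sx Sy).
have fxz : f x <> f z by move=> /(finj _ _ Sx Sz).
have fyz : f y <> f z by move=> /(finj _ _ Sy Sz).
by have /= := f2 _ Sx; have /= := f2 _ Sy; have /= := f2 _ Sz; lia.
Qed.

(* A point of K outside |z| <= r would give the sphere complement three relatively
   clopen pieces: one in K, the disc |z| <= r, and one containing infinity. *)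
Lemma connectivity2_no_hole V K (r s t M d : R) :
  open V -> annulus s t `<=` V -> 0 <= r -> s < r < t -> 0 < d ->
  (forall z, K z -> ~ V z) -> (forall z, K z -> cmod z <= M) ->
  (forall z w, K z -> ~ V w -> cmod (w - z) < d -> K w) ->
  has_connectivity (V `&` [set z | r < cmod z]) 2 ->
  forall z, K z -> cmod z <= r.
Proof.
move=> oV aV r0 /andP[sr rt] d0 KV KM Kd conn2 x Kx; rewrite leNgt; apply/negP => rx.
set G := V `&` _ in conn2.
have VKt z : ~ V z -> r < cmod z -> t <= cmod z.
  move=> nVz rz; rewrite leNgt; apply/negP => zt; apply: nVz; apply: aV.
  by rewrite /annulus /= zt andbT; exact: lt_trans rz.
(* The annulus leaves no point of the complement with r < |z| < t, so the closed condition
   [t <= cmod z] selects the same points of K as [r < cmod z]. *)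
pose A1 := [set z | K z /\ t <= cmod z].
pose O1 := (\bigcup_(v in A1) disc v d) `&` [set z : C | r < cmod z].
pose A2 := [set z : C | cmod (z - 0) <= r]; pose O2 := disc (0 : C) t.
have out_open : open [set z : C | r < cmod z].
  apply/open_cmodP => z /= rz; exists (cmod z - r); first by rewrite subr_gt0.
  by move=> w wz; have := cmod_leB z w; rewrite cmodB; move: wz; lra.
have cA1 : closed A1.
  move=> z /closure_cmodP zA.
  have nVz : ~ V z.
    move=> /((@open_cmodP R V).1 oV)[e e0 eV].
    by have [w [Kw _] wz] := zA e e0; apply: KV Kw _; exact: eV.
  split; first by have [w [Kw _] wz] := zA d d0; apply: Kd Kw nVz _; rewrite cmodB.
  apply/ler_addgt0Pl => e /zA[w [_ tw] wz].
  by have := cmod_leB w z; move: wz tw; lra.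
have coA1 : compact A1 by apply: (compact_closed_bounded (M := M) cA1) => z [/KM zM _].
have cA2 : closed A2 by exact: closed_cdisc.
have coA2 : compact A2.
  by apply: (compact_closed_bounded (M := r) cA2) => z; rewrite /A2 /= subr0.
have oO1 : open O1 by apply: openI => //; apply: bigcup_open => v _; exact: disc_open.
have AO1 : A1 `<=` O1.
  move=> z Az; split; first by exists z => //; exact: disc_center.
  exact: lt_le_trans rt Az.2.
have OG1 z : O1 z -> ~ G z -> A1 z.
  move=> [[v [Kv _] zv] rz] nGz; have nVz : ~ V z by move=> Vz; apply: nGz.
  by split; [exact: Kd Kv nVz zv|exact: VKt].
have oO2 : open O2 by exact: disc_open.
have AO2 : A2 `<=` O2 by move=> z zr; exact: le_lt_trans zr rt.
have OG2 z : O2 z -> ~ G z -> A2 z.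
  rewrite /O2 /A2 /disc /= subr0 => zt nGz; rewrite leNgt; apply/negP => rz.
  apply: nGz; split => //; apply: aV; rewrite /annulus /= zt andbT.
  exact: lt_trans rz.
have Y1 : sphere_compl G (Some x).
  by move=> [z [Vz _] [zx]]; apply: KV Kx _; rewrite -zx.
have Y2 : sphere_compl G (Some (0 : C)).
  by move=> [z [_ /= rz] [zx]]; move: rz; rewrite zx cmod0 ltNge r0.
have Y3 : sphere_compl G None by move=> [].
have Ax : (Some @` A1 : set sphere) (Some x).
  by exists x => //; split => //; apply: VKt => //; exact: KV.
have A0 : (Some @` A2 : set sphere) (Some (0 : C)).
  by exists 0 => //; rewrite /A2 /= subr0 cmod0.
have im p : sphere_compl G p ->
    (connected_component (sphere_compl G) @` sphere_compl G)
      (connected_component (sphere_compl G) p) by move=> Yp; exists p.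
have self p q : sphere_compl G q -> connected_component (sphere_compl G) p =
    connected_component (sphere_compl G) q -> connected_component (sphere_compl G) p q.
  by move=> Yq ->; exact: connected_component_refl.
apply: three_not_card2 (im _ Y1) (im _ Y2) (im _ Y3) _ _ _ conn2.
- move=> /(self _ _ Y2) /(clopen_component coA1 cA1 oO1 AO1 OG1) /(_ Ax).
  by move=> [z [_ tz] [z0]]; move: tz; rewrite z0 cmod0 leNgt (le_lt_trans r0 rt).
- by move=> /(self _ _ Y3) /(clopen_component coA1 cA1 oO1 AO1 OG1) /(_ Ax) [].
- by move=> /(self _ _ Y3) /(clopen_component coA2 cA2 oO2 AO2 OG2) /(_ A0) [].
Qed.

End Sphere_components.

(** * The outer boundary *)

Section Outer_boundary.
Context {R : realType}.
Local Notation C := (Cplx R).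
Implicit Types (z w p : C) (V : set C) (g : C -> C).

Lemma clamp_lipschitz (x y : R) :
  `|Num.min 1 (Num.max 0 x) - Num.min 1 (Num.max 0 y)| <= `|x - y|.
Proof.
have maxL (u v : R) : `|Num.max 0 u - Num.max 0 v| <= `|u - v|.
  have uv := ler_norm (u - v); have := ler_norm (v - u); rewrite distrC => vu.
  by rewrite ler_norml /Num.max; case: (ltP 0 u) => ?; case: (ltP 0 v) => ?;
    apply/andP; split; lra.
have minL (u v : R) : `|Num.min 1 u - Num.min 1 v| <= `|u - v|.
  have uv := ler_norm (u - v); have := ler_norm (v - u); rewrite distrC => vu.
  by rewrite ler_norml /Num.min; case: (ltP 1 u) => ?; case: (ltP 1 v) => ?;
    apply/andP; split; lra.
exact: le_trans (minL _ _) (maxL _ _).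
Qed.

Lemma outer_boundary_large V g (B S T r s t : R) :
  open V -> connected V -> 0 < B -> (forall z, V z -> cmod z < B) ->
  entire g -> S < T ->
  (forall z, closure V z -> ~ V z -> cmod (g z) <= S \/ T <= cmod (g z)) ->
  (exists2 z, V z & S < cmod (g z)) ->
  annulus s t `<=` V -> 0 <= r -> s < r < t ->
  has_connectivity (V `&` [set z | r < cmod z]) 2 ->
  forall z, closure V z -> ~ V z -> r < cmod z -> T <= cmod (g z).
Proof.
move=> oV cV B0 VB gE ST gbd [z1 Vz1 gz1] aV r0 srt conn2.
have TS0 : 0 < T - S by rewrite subr_gt0.
(* Clamping makes the boundary values exactly 0 or 1; the Lipschitz constant L / (T - S) dictates h
   below. *)
pose lam z := Num.min 1 (Num.max 0 ((cmod (g z) - S) / (T - S))).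
have [L L0 gL] := entire_lipschitz B gE.
have L10 : 0 < 8 * (L + 1) by rewrite mulr_gt0// ltr_wpDl.
have [h [h0 h1 hL]] : exists h : R,
    [/\ 0 < h, h <= 1 & h <= (T - S) / (8 * (L + 1))].
  exists (Num.min 1 ((T - S) / (8 * (L + 1)))).
  by rewrite lt_min ltr01 divr_gt0// !ge_min !lexx orbT.
have lam_unif z w : cmod z <= B -> cmod w <= B -> cmod (z - w) < h ->
    `|lam z - lam w| < 8^-1.
  move=> zB wB zw; apply: le_lt_trans (clamp_lipschitz _ _) _.
  have -> : (cmod (g z) - S) / (T - S) - (cmod (g w) - S) / (T - S) =
      (cmod (g z) - cmod (g w)) / (T - S) by field; rewrite gt_eqF.
  rewrite normrM normfV (gtr0_norm TS0) ltr_pdivrMr//.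
  have gzw : `|cmod (g z) - cmod (g w)| <= L * cmod (z - w).
    apply: le_trans (gL z w zB wB); rewrite ler_norml.
    have := cmod_leB (g z) (g w); have := cmod_leB (g w) (g z).
    by rewrite (cmodB (g w)); lra.
  apply: le_lt_trans gzw _.
  have zwT : cmod (z - w) < (T - S) / (8 * (L + 1)) by exact: lt_le_trans zw hL.
  rewrite ltr_pdivlMr// in zwT; have := cmod_ge0 (z - w).
  move: zwT; set x := cmod _; move: x => x zwT x0.
  by have := mulr_ge0 L0 x0; have [x1|x1] := ltP 0 x; nra.
have lam0E z : cmod (g z) <= S -> lam z = 0.
  move=> gS; rewrite /lam; have -> : Num.max 0 ((cmod (g z) - S) / (T - S)) = 0.
    by apply/max_idPl; rewrite pmulr_lle0 ?invr_gt0// subr_le0.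
  by apply/min_idPr; exact: ler01.
have lam1E z : T <= cmod (g z) -> lam z = 1.
  move=> gT; apply/min_idPl; rewrite le_max; apply/orP; right.
  by rewrite ler_pdivlMr// mul1r lerB.
have lam_bd p : closure V p -> ~ V p -> lam p = 0 \/ lam p = 1.
  by move=> Vp nVp; case: (gbd p Vp nVp) => [/lam0E|/lam1E]; [left|right].
have [K [KV KM [d d0 Kd]] cases] :=
  boundary_splitting oV cV B0 VB h0 h1 lam_unif lam_bd.
case: cases => [PK|QK].
  have Kr := connectivity2_no_hole oV aV r0 srt d0 KV KM Kd conn2.
  move=> z Vz nVz rz; case: (gbd z Vz nVz) => // /lam0E/(PK z Vz nVz)/Kr.
  by rewrite leNgt rz.
(* W is open since K is relatively open off V. Its frontier consists of boundary points of V outside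
   K, where |g| <= S. *)
exfalso; pose W := V `|` K.
have oW : open W.
  apply/open_cmodP => z [/((@open_cmodP R V).1 oV)[e e0 eV]|Kz].
    by exists e => // w /eV; left.
  exists d => // w wz; have [Vw|nVw] := pselect (V w); first by left.
  by right; exact: Kd Kz nVw wz.
have WB z : W z -> cmod z <= 2 * B.
  by case=> [/VB|/KM//]; move: B0; lra.
suff : cmod (g z1) <= S by rewrite leNgt gz1.
apply: (max_principle oW WB) => [z _|z Wz nWz|]; last by left.
  exact: gE.
have nVz : ~ V z by move=> Vz; apply: nWz; left.
have nKz : ~ K z by move=> Kz; apply: nWz; right.
have Vz : closure V z.
  apply/closure_cmodP => e e0; have m0 : 0 < Num.min e d by rewrite lt_min e0.
  have [w [Vw|Kw] wz] := (@closure_cmodP R W z).1 Wz _ m0.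
    by exists w => //; move: wz; rewrite lt_min => /andP[].
  by exfalso; apply/nKz/(Kd w) => //; move: wz; rewrite lt_min cmodB => /andP[].
by case: (gbd z Vz nVz) => // /lam1E/(QK z Vz nVz).
Qed.

(* Minimum principle for log|g|, compared with the radial harmonic function
   that vanishes on |z| = s' and is at most log T on |z| <= X. *)
Lemma radial_lower_bound V g (X T r s s' t : R) (p : nat) :
  open V -> (forall z, V z -> cmod z <= X) -> entire g ->
  annulus s t `<=` V -> s < s' < r -> r < t -> 0 < s' -> 0 < T ->
  (forall z, V z -> 1 <= cmod (g z)) ->
  (forall z, closure V z -> ~ V z -> r < cmod z -> T <= cmod (g z)) ->
  X ^+ p <= s' ^+ p * T ->
  forall z, V z -> cmod z = r -> r ^+ p <= s' ^+ p * cmod (g z).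
Proof.
move=> oV VX gE aV /andP[ss' s'r] rt s'0 T0 g1 gT XT z0 Vz0 z0r.
(* Cutting at s' removes the inner boundary of V, where |g| may be small compared with T. *)
pose Om := V `&` [set z : C | s' < cmod z].
have oOm : open Om.
  apply: openI => //; apply/open_cmodP => z /= rz; exists (cmod z - s').
    by rewrite subr_gt0.
  by move=> w wz; have := cmod_leB z w; rewrite cmodB; move: wz; lra.
have OmV z : closure Om z -> closure V z by apply: closureS => ? [].
have gcl z : closure Om z -> 1 <= cmod (g z).
  move=> /OmV/closure_cmodP Vz; apply/ler_addgt0Pl => e e0.
  have [d d0 dP] := cmod_derivable_cts (gE z) e0.
  have [w /g1 gw /dP] := Vz d d0; rewrite ltr_norml; move: gw; lra.
have gn0 z : closure Om z -> g z != 0.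
  by move=> /gcl gz; rewrite -cmod_gt0; exact: lt_le_trans gz.
have clX z : closure Om z -> cmod z <= X by move=> /OmV; exact: cmod_closure_le.
have cls' z : closure Om z -> s' <= cmod z.
  move=> /closure_cmodP Omz; apply/ler_addgt0Pl => e /Omz[w [_ /= sw] wz].
  by have := cmod_leB w z; move: wz sw; lra.
have := @max_principle R Om (fun z => z ^+ p / g z) X (s' ^+ p) oOm.
move=> /(_ (fun z Oz => VX z Oz.1)) H.
have {H} : cmod (z0 ^+ p / g z0) <= s' ^+ p.
  apply: H.
  - move=> z cz; apply: derivable_quotient; [|exact: gE|exact: gn0].
    exact: (@derivable_pow R (fun w => w) z p (@derivable1_id _ z)).
  - move=> z cz nOz; have gz0 : 0 < cmod (g z) by rewrite cmod_gt0 gn0.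
    rewrite cmodM cmodV cmodX ler_pdivrMr//.
    (* On the circle |z| = s' the bound |g| >= 1 suffices; any other frontier point of [Om] is
       pushed by the annulus beyond t > r, where |g| >= T. *)
    have := cls' z cz; rewrite le_eqVlt => /orP[/eqP <-|s'z].
      by rewrite ler_peMr ?gcl// exprn_ge0// ltW.
    have nVz : ~ V z by move=> Vz; apply: nOz.
    have rz : r < cmod z.
      rewrite (lt_le_trans rt)// leNgt; apply/negP => zt; apply: nVz; apply: aV.
      by rewrite /annulus /= zt andbT; exact: lt_trans s'z.
    apply: le_trans (_ : X ^+ p <= _).
      by rewrite lerXn2r ?nnegrE ?cmod_ge0 ?clX// (le_trans (cmod_ge0 z))// clX.
    apply: le_trans XT _; rewrite ler_pM2l ?exprn_gt0//.
    by apply: gT => //; exact: OmV.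
  - by split => //=; rewrite z0r.
rewrite cmodM cmodV cmodX z0r ler_pdivrMr// cmod_gt0 gn0//.
by apply: subset_closure; split => //=; rewrite z0r.
Qed.

End Outer_boundary.

(** * Boundedness of the outer exponents *)

Theorem theorem1p8 (R : realType) (f : Cplx R -> Cplx R) (U : set (Cplx R))
    (z0 : Cplx R) (r a_ b_ : nat -> R) (b : \bar R)
    (f_transc : transcendental_entire f)
    (U_wandering : wandering_domain f U)
    (U_multconn : multiply_connected U)
    (U_z0 : U z0)
    (r_def : forall n, r n = cmod (iter n f z0))
    (ab_def : \forall n \near \oo,
       maximal_annulus (fatou_orbit f U n) (iter n f z0)
         (r n `^ a_ n) (r n `^ b_ n))
    (b_def : (b_ n)%:E @[n --> \oo] --> b)
    (outer_conn2 : eventual_outer_connectivity f U z0 2) :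
  b \is a fin_num.
Proof.
have [fE f_npoly] := f_transc.
have f_nc w : exists v, f v != f w.
  apply: contrapT => nov; apply: f_npoly; exists ((f w)%:P) => z.
  by rewrite hornerC; apply/eqP; apply: contrapT => /negP fz; apply: nov; exists z.
have [N0 _ N0P] := ab_def.
pose s n := r n `^ a_ n; pose t n := r n `^ b_ n.
have st n : (N0 <= n)%N -> [/\ 0 < s n, annulus (s n) (t n) `<=` fatou_orbit f U n
    & s n < cmod (iter n f z0) < t n].
  by move=> /N0P[/andP[s0 _] aV az _].
have [N1 N01 N1P] := r_unbounded fE f_nc U_wandering U_z0 st 1.
have b1 n : (N1 <= n)%N -> 1 < b_ n.
  move=> N1n; have [_ _ /andP[_]] := st n (leq_trans N01 N1n).
  have := N1P n N1n; rewrite -r_def /t => r1 rt; rewrite ltNge; apply/negP => bn1.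
  by have := ler1_powR (ltW r1) bn1; rewrite leNgt rt.
(* The limit -oo contradicts b_n > 1; the rest refutes +oo. *)
case: b b_def => [//| |] b_def; exfalso; last first.
  move/cvgeNyPle: b_def => /(_ 0)[N _ NP].
  have := NP _ (leq_maxl N N1); rewrite /= lee_fin leNgt.
  by rewrite (lt_trans ltr01)// b1// leq_maxr.
have [N2 _ N2P] := outer_conn2.
pose m := maxn N1 N2; have N1m : (N1 <= m)%N by exact: leq_maxl.
have N0m := leq_trans N01 N1m.
have conn2 := N2P m (leq_maxr N1 N2).
have [sm0 aV /andP[sr rt]] := st m N0m.
set rm := cmod (iter m f z0) in sr rt.
have rm1 : 1 < rm by exact: N1P.
pose V := fatou_orbit f U m.
have oV : open V by exact: (orbit_open fE f_nc U_wandering U_z0).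
pose X := s m.+1 + 1.
have VX z : V z -> cmod z < X.
  move=> Vz; apply: le_lt_trans (_ : s m.+1 < X); last by rewrite /X ltrDl.
  exact: (orbit_inside fE f_nc U_wandering U_z0 st N0m (ltnSn m)).
have Vm : V (iter m f z0) by exact: (orbit_mem fE f_nc U_wandering U_z0).
have X0 : 0 < X by exact: le_lt_trans (cmod_ge0 _) (VX _ Vm).
(* The circle |z| = s' lies in the annulus of [V], inside the one through the orbit point. *)
pose s' := (s m + rm) / 2.
have ss' : s m < s' by rewrite /s'; lra.
have s'r : s' < rm by rewrite /s'; lra.
have s'0 : 0 < s' by exact: lt_trans ss'.
clearbody s'; pose x := rm / s'.
have x1 : 1 < x by rewrite ltr_pdivlMr// mul1r.
(* q exceeds log (X / s') / log x, the inverse of the constant c between log [rM] and log [t M]. *)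
have [q qP] := pow_unbounded (X / s') x1.
have [N3 N3m N3P] := r_unbounded fE f_nc U_wandering U_z0 st x.
move/cvgeyPge: b_def => /(_ (2 * q)%:R)[N4 _ N4P].
pose n := (maxn N3 N4).+1; pose M := (m + n)%N.
have N3M : (N3 <= M)%N.
  by rewrite /M /n addnS leqW// (leq_trans (leq_maxl N3 N4))// leq_addl.
have N4M : (N4 <= M)%N.
  by rewrite /M /n addnS leqW// (leq_trans (leq_maxr N3 N4))// leq_addl.
have mM : (m < M)%N by rewrite /M /n addnS ltnS leq_addr.
have N0M : (N0 <= M)%N by exact: leq_trans N0m (ltnW mM).
have [sM0 aM /andP[srM rtM]] := st M N0M.
have rMx := N3P M N3M.
have bM := N4P M N4M; rewrite /= lee_fin in bM.
set rM := cmod (iter M f z0) in srM rtM rMx.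
pose g := iter n f.
have gE : entire g by exact: entire_iter.
have gM : cmod (g (iter m f z0)) = rM by rewrite /rM /M addnC iterD.
have gV z : V z -> fatou_orbit f U M (g z).
  exact: (orbit_map fE f_nc U_wandering U_z0).
have g1 z : V z -> 1 <= cmod (g z).
  move=> /gV /(orbit_outside fE f_nc U_wandering U_z0 st N0m mM).
  by apply: le_trans; exact/ltW/(lt_trans rm1).
have gbd z : closure V z -> ~ V z -> cmod (g z) <= s M \/ t M <= cmod (g z).
  move=> Vz nVz; have nF := orbit_boundary fE f_nc U_wandering U_z0 Vz nVz.
  have := iter_not_fatou fE (n := n) nF; rewrite -/g => nFg.
  have [gs|gs] := leP (cmod (g z)) (s M); first by left.
  right; rewrite leNgt; apply/negP => gt; apply: nFg.
  apply: (orbit_sub fE f_nc U_wandering U_z0 (n := M)); apply: aM.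
  by rewrite /annulus /= gs gt.
have gT : forall z, closure V z -> ~ V z -> rm < cmod z -> t M <= cmod (g z).
  apply: (outer_boundary_large oV _ X0 VX gE (lt_trans srM rtM) gbd _ aV _ _ conn2).
  - exact: (orbit_connected fE f_nc U_wandering U_z0).
  - by exists (iter m f z0) => //; rewrite gM.
  - exact: cmod_ge0.
  - by rewrite sr rt.
have key p : (X / s') ^+ p <= t M -> x ^+ p <= rM.
  move=> XT; rewrite expr_div_n ler_pdivrMr ?exprn_gt0// mulrC -gM.
  apply: (@radial_lower_bound R V g X (t M) rm (s m) s' (t m)) => //.
  - by move=> z /VX/ltW.
  - by rewrite ss' s'r.
  - by rewrite (lt_trans (lt_trans sM0 srM)).
  - by move: XT; rewrite expr_div_n ler_pdivrMr ?exprn_gt0// mulrC.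
have rM1 : 1 < rM by exact: lt_trans rMx.
have exk : exists k, rM < x ^+ k by have [k kP] := pow_unbounded rM x1; exists k.
(* k is log [rM] / log x rounded up. Since [rM] > x it is at least 2, so k <= 2 (k - 1): rounding is
   absorbed by the 2 in [2 * q]. *)
case: (ex_minnP exk) => k kP kmin.
have x0 : 0 < x by exact: lt_trans x1.
have k2 : (2 <= k)%N.
  case: k kP {kmin} => [|[|//]]; rewrite ?expr0 ?expr1 => kP.
    by have := lt_trans kP rM1; rewrite ltxx.
  by have := lt_trans kP rMx; rewrite ltxx.
have kk : (k <= k.-1 * 2)%N.
  case: k {kP kmin} k2 => [|[|k]]// _.
  by rewrite muln2 -addnn addSn addnS !ltnS leq_addr.
have xk1 : x ^+ k.-1 <= rM.
  rewrite leNgt; apply/negP => /kmin.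
  by rewrite leqNgt ltn_predL (leq_trans _ k2).
(* The chain is (X / s')^k <= x^(q k) <= x^((k - 1) 2 q) <= rM^(2 q) <= rM^(b_M) = t M. *)
suff /key : (X / s') ^+ k <= t M by rewrite leNgt kP.
have Xs0 : 0 <= X / s' by rewrite divr_ge0// ltW.
apply: le_trans (_ : (x ^+ q) ^+ k <= _).
  by rewrite lerXn2r ?nnegrE ?exprn_ge0// ltW.
apply: le_trans (_ : (x ^+ k.-1) ^+ (2 * q) <= _).
  rewrite -!exprM ler_weXn2l ?(ltW x1)// [(2 * q)%N]mulnC mulnCA leq_mul2l.
  by rewrite kk orbT.
apply: le_trans (_ : rM ^+ (2 * q) <= _).
  by rewrite lerXn2r ?nnegrE ?exprn_ge0// ltW// (lt_trans ltr01).
rewrite /t r_def -/rM -powR_mulrn; last by rewrite ltW// (lt_trans ltr01).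
by rewrite ler_powR// ltW.
Qed.
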